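(* Let $n\in\mathbb{N}$, $n\ge 2$, let $X_1,\dots,X_n$ be i.i.d. with distribution $\mathbb{P}\in\mathcal{P}(\mathcal{X})$, let $\delta\in(0,1)$, and let $k$ be a characteristic translation invariant kernel defined from a positive definite function $\psi$, i.e. $k(x,x')=\psi(x'-x)$. Then with probability at least $1-\delta$, it holds that $$\left\|\widehat{\mu}_{\mathbb{P}}-\mu_{\mathbb{P}}\right\|_{\mathcal{H}_k}\le \sqrt{2\,\widehat{v}(X_1,\dots,X_n)\,\frac{\log(4/\delta)}{n}}+\frac{16}{3}\sqrt{\Delta\psi}\,\frac{\log(4/\delta)}{n},$$ where $$\widehat{v}(X_1,\dots,X_n)=\overline{\psi}-\frac{1}{(n-1)n}\sum_{t\ne s}\psi(X_t-X_s),$$ the sum ranging over ordered pairs $(t,s)\in\{1,\dots,n\}^2$ with $t\neq s$.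
   Context: $\mathcal{X}$ is a separable topological space (with an additive group structure, e.g. $\mathbb{R}^d$, so that differences $x'-x\in\mathcal{X}$ make sense), and $\mathcal{P}(\mathcal{X})$ is the set of Borel probability measures on $\mathcal{X}$. The kernel $k\colon\mathcal{X}\times\mathcal{X}\to\mathbb{R}$ is a continuous, bounded ($\sup_x k(x,x)<\infty$) positive definite kernel with RKHS $\mathcal{H}_k$. It is translation invariant: there is a positive definite function $\psi\colon\mathcal{X}\to\mathbb{R}$ with $k(x,x')=\psi(x'-x)$ for all $x,x'\in\mathcal{X}$. It is characteristic: $\mathbb{P}\mapsto\mu_{\mathbb{P}}$ is injective on $\mathcal{P}(\mathcal{X})$. Notation: $\overline{\psi}=\sup_{x\in\mathcal{X}}\psi(x)=\psi(0)$, $\underline{\psi}=\inf_{x\in\mathcal{X}}\psi(x)$, $\Delta\psi=\overline{\psi}-\underline{\psi}$ (and $\Delta\psi>0$ as $\psi$ is not constant). The kernel mean embedding is the Bochner integral $\mu_{\mathbb{P}}=\mathbb{E}_{X\sim\mathbb{P}}[k(X,\cdot)]\in\mathcal{H}_k$ and $\widehat{\mu}_{\mathbb{P}}=\frac1n\sum_{t=1}^n k(X_t,\cdot)$. *)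

(* Defs.v *)
From HB Require Import structures.
From mathcomp Require Import all_boot all_order all_algebra.
From mathcomp Require Import all_classical all_reals all_analysis.

Set Implicit Arguments.
Unset Strict Implicit.
Unset Printing Implicit Defensive.

Import Order.TTheory GRing.Theory Num.Theory.
Import numFieldNormedType.Exports.

Local Open Scope classical_set_scope.
Local Open Scope ring_scope.

(* [PreTopologicalZmodule.type] is a topological space together with an
   additive group structure; no compatibility between the two is assumed. *)

Definition separable (S : topologicalType) : Prop :=
  exists D : set S, countable D /\ dense D.

(* [borel S] is an alias of [S] that carries the Borel sigma-algebra;
   the point 0 is only there because measurable types must be pointed. *)
Definition borel (S : PreTopologicalZmodule.type) : Type := S.

Section borel_instance.
Variable S : PreTopologicalZmodule.type.

HB.instance Definition _ := Choice.copy (borel S) S.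
HB.instance Definition _ := isPointed.Build (borel S) (0 : S).

Let opens : set (set (borel S)) := @open S.

HB.instance Definition _ := @isMeasurable.Build (sigma_display opens)
  (borel S) <<s opens >>
  (@sigma_algebra0 _ setT opens)
  (fun A sA => @sigma_algebraC (borel S) opens A sA)
  (@sigma_algebra_bigcup _ setT opens).

End borel_instance.

Section positive_definiteness.
Context {R : realType}.

Definition positive_definite_kernel (T : Type) (k : T -> T -> R) : Prop :=
  (forall x y, k x y = k y x) /\
  (forall (m : nat) (a : 'I_m -> R) (x : 'I_m -> T),
     0 <= \sum_(i < m) \sum_(j < m) a i * a j * k (x i) (x j)).

Definition positive_definite_function (S : zmodType) (psi : S -> R) : Prop :=
  positive_definite_kernel (fun x x' => psi (x' - x)).

End positive_definiteness.

(* A reproducing kernel Hilbert space of [k]: a Hilbert space whose elements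
   are functions [T -> R] (through the injective linear map [rkhs_eval]),
   which contains each [k x] (as [rkhs_section x]) and satisfies the
   reproducing property.  It is unique up to isometric isomorphism. *)
Structure rkhs (R : realType) (T : Type) (k : T -> T -> R) := Rkhs {
  rkhs_space :> completeNormedModType R ;
  rkhs_dot : {dot rkhs_space for @idfun R} ;
  rkhs_normE : forall f, `|f| ^+ 2 = rkhs_dot f f ;
  rkhs_eval : rkhs_space -> T -> R ;
  rkhs_eval_linear : forall a f g x,
    rkhs_eval (a *: f + g) x = a * rkhs_eval f x + rkhs_eval g x ;
  rkhs_eval_inj : injective rkhs_eval ;
  rkhs_section : T -> rkhs_space ;
  rkhs_sectionE : forall x, rkhs_eval (rkhs_section x) = k x ;
  rkhs_reproducing : forall f x, rkhs_eval f x = rkhs_dot f (rkhs_section x)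
}.

Section bochner.
Context {d : measure_display} {T : measurableType d} {R : realType}.
Context {V : normedModType R}.

Definition simple_function (s : T -> V) : Prop :=
  finite_set (range s) /\ (forall v, measurable (s @^-1` [set v])).

Definition simple_integral (P : probability T R) (s : T -> V) : V :=
  \sum_(v \in range s) fine (P (s @^-1` [set v])) *: v.

(* The pointwise convergence says that [f] is strongly measurable; it makes
   the functions under the Lebesgue integral measurable. *)
Definition is_bochner_integral (P : probability T R) (f : T -> V) (I : V) :
    Prop :=
  exists s : nat -> T -> V,
    [/\ forall m, simple_function (s m),
        forall x, s m x @[m --> \oo] --> f x,
        (\int[P]_x (`|f x - s m x|)%:E)%E @[m --> \oo] --> 0%E
      & simple_integral P (s m) @[m --> \oo] --> I].

(* Junk value 0 when [f] is not Bochner integrable. *)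
Definition bochner_integral (P : probability T R) (f : T -> V) : V :=
  xget 0 [set I | is_bochner_integral P f I].

End bochner.

Section mean_embedding.
Context {R : realType} {S : PreTopologicalZmodule.type} {k : S -> S -> R}.
Variable H : rkhs k.

Definition mean_embedding (P : probability (borel S) R) : H :=
  bochner_integral P (fun x : borel S => rkhs_section H x).

Definition empirical_embedding (n : nat) (x : 'I_n -> S) : H :=
  n%:R^-1 *: \sum_(t < n) rkhs_section H (x t).

(* Two measures are the same when they agree on the measurable sets: the
   library leaves their values on the other sets unconstrained. *)
Definition characteristic : Prop :=
  forall P Q : probability (borel S) R,
    mean_embedding P = mean_embedding Q ->
    forall A, measurable A -> P A = Q A.

End mean_embedding.

Section iid.
Context {d d' : measure_display} {Omega : measurableType d}.
Context {T : measurableType d'} {R : realType} (Pr : probability Omega R).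

Definition mutually_independent (n : nat) (X : 'I_n -> {RV Pr >-> T}) : Prop :=
  forall (J : {set 'I_n}) (A : 'I_n -> set T),
    (forall t, measurable (A t)) ->
    Pr (\bigcap_(t in [set` J]) (X t @^-1` A t)) =
    (\prod_(t in J) Pr (X t @^-1` A t))%E.

Definition iid (P : probability T R) (n : nat) (X : 'I_n -> {RV Pr >-> T}) :
    Prop :=
  mutually_independent X /\
  (forall t A, measurable A -> distribution Pr (X t) A = P A).

End iid.

Section variance_proxy.
Context {R : realType} {S : zmodType}.
Variable psi : S -> R.

Definition psi_range : R := sup (range psi) - inf (range psi).

Definition vhat (n : nat) (x : 'I_n -> S) : R :=
  sup (range psi) -
  ((n%:R - 1) * n%:R)^-1 *
    \sum_(t < n) \sum_(s < n | t != s) psi (x t - x s).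

End variance_proxy.

(* Main.v *)
Require Import Defs.
From HB Require Import structures.
From mathcomp Require Import all_boot all_order fingroup perm all_algebra finmap.
From mathcomp Require Import all_classical all_reals all_analysis.
From mathcomp Require Import measurable_realfun.
From mathcomp Require Import ring lra zify.

(** Write [phi x] for the section [k x], an element of the Hilbert space [H].
    Translation invariance makes every [phi x] of the same norm, and
    [|phi x - phi y|^2 / 2 = psi 0 - psi (x - y)] lies between 0 and
    [psi_range psi].  The sum in [vhat] is therefore the unbiased sample
    variance of the vectors [phi (X t)], a U-statistic, and the statement is
    an empirical Bernstein inequality for bounded independent random vectors
    of a Hilbert space.  With [L = ln (4 / delta)], [D = psi_range psi] and [v]
    the true variance, two tail bounds are combined.

    - Bernstein inequality of Pinelis type ([hilbert_bernstein_tail]): outside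
      an event of probability [2 exp (- L)], the distance of the empirical mean
      to the mean is at most
      [sqrt (2 v L / n) + 5/4 sqrt (2 D) L / n].  Its core is the pointwise
      inequality [cosh_norm_increment], which bounds [cosh |x + d|] by
      [cosh |x| (exp |d| - |d|)] plus a term linear in [d]; that term has mean
      zero when [d] is centered, so that [E cosh |S_n|] is multiplicatively
      controlled along the sample.

    - Lower tail of the sample variance ([empirical_variance_lower_tail]):
      outside an event of probability [exp (- L)], [sqrt v] is at most
      [sqrt vhat + sqrt (6 D L / n)].  Following Hoeffding, the U-statistic
      is the average over all permutations of the sample of means of [n/2]
      independent nonnegative terms, and Jensen's inequality reduces its
      Laplace transform to theirs.

    Since [5/4 sqrt 2 + sqrt 12 <= 16/3], both bounds give the announced one,
    with probability at least [1 - 3 delta / 4].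

    Both tail bounds are proved for a sample that takes finitely many values,
    where expectations are finite sums.  The general case is a limit: as [phi] is
    continuous on a separable space, it is the pointwise limit of simple
    functions with values in the range of [phi], so with the same [D]
    ([ex_simple_approximation]).  Their integrals converge to the
    mean embedding, because Bochner integrals exist and are unique
    ([ex_bochner_integral], [bochner_integral_unique]); and closed events pass to
    the limit by reverse Fatou ([probability_le0_limit]). *)

Set Implicit Arguments.
Unset Strict Implicit.
Unset Printing Implicit Defensive.

Import Order.TTheory GRing.Theory Num.Theory.
Import numFieldNormedType.Exports.

Local Open Scope classical_set_scope.
Local Open Scope ring_scope.

(** * Real inequalities *)

Section real_inequalities.
Context {R : realType}.
Implicit Types (x y a b c s t : R).

Lemma ge0_derive_le_at0 (f df : R -> R) x :
  (forall y, is_derive y 1 f (df y)) -> (forall y, 0 <= y -> 0 <= df y) ->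
  0 <= x -> f 0 <= f x.
Proof.
move=> fdf df0 x0.
have cf : {within `[0, x], continuous f}.
  apply: continuous_subspaceT => z.
  apply: differentiable_continuous; apply/derivable1_diffP.
  by have [] := fdf z.
have [c] := MVT_segment x0 (fun y _ => fdf y) cf.
rewrite in_itv /= => /andP[c0 _] E.
by rewrite -subr_ge0 E mulr_ge0 ?df0// subr0.
Qed.

(** Up to a rearrangement, [exp x - 1 - x <= x^2 / (2 (1 - x))] on [0, 1[:
    the form in which moments are bounded in Bernstein's inequality. *)
Lemma expR_le_bernstein x : 0 <= x -> (1 - x) * expR x <= 1 - x ^+ 2 / 2.
Proof.
move=> x0.
pose f (y : R) : R := 1 - y ^+ 2 / 2 - (1 - y) * expR y.
have : f 0 <= f x.
  apply: (@ge0_derive_le_at0 _ (fun y => y * (expR y - 1))) => // [y|y y0].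
    apply: is_derive_eq.
    by rewrite /GRing.scale /=; field.
  by rewrite mulr_ge0// subr_ge0 -[1]expR0 ler_expR.
by rewrite /f expR0; lra.
Qed.

Lemma expRN_le_quadratic x : 0 <= x -> expR (- x) <= 1 - x + x ^+ 2 / 2.
Proof.
move=> x0.
pose f (y : R) : R := 1 - y + y ^+ 2 / 2 - expR (- y).
have : f 0 <= f x.
  apply: (@ge0_derive_le_at0 _ (fun y => expR (- y) - (1 - y))) => // [y|y y0].
    apply: is_derive_eq.
    by rewrite /GRing.scale /=; field.
  by have := expR_ge1Dx (- y); lra.
by rewrite /f oppr0 expR0; lra.
Qed.

Definition cosh x := (expR x + expR (- x)) / 2.
Definition sinh x := (expR x - expR (- x)) / 2.

Lemma sinh_ge_id x : 0 <= x -> x <= sinh x.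
Proof.
move=> x0.
pose f (y : R) : R := (expR y - expR (- y)) / 2 - y.
have : f 0 <= f x.
  apply: (@ge0_derive_le_at0 _ (fun y => (expR y + expR (- y)) / 2 - 1)) => // [y|y y0].
    apply: is_derive_eq.
    by rewrite /GRing.scale /=; field.
  by have := expR_ge1Dx y; have := expR_ge1Dx (- y); lra.
by rewrite /f /sinh oppr0; lra.
Qed.

Lemma coshDsinh x : cosh x + sinh x = expR x.
Proof. by rewrite /cosh /sinh; field. Qed.

Lemma coshD x y : cosh (x + y) = cosh x * cosh y + sinh x * sinh y.
Proof. by rewrite /cosh /sinh opprD !expRD; field. Qed.

Lemma coshB x y : cosh (x - y) = cosh x * cosh y - sinh x * sinh y.
Proof. by rewrite /cosh /sinh opprB !expRD addrC; field. Qed.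

Lemma cosh_gt0 x : 0 < cosh x.
Proof. by rewrite divr_gt0// addr_gt0 ?expR_gt0. Qed.

Lemma sinh_le_cosh x : sinh x <= cosh x.
Proof. by rewrite /sinh /cosh; have := expR_gt0 (- x); lra. Qed.

Lemma cvg_cosh_series x :
  series (fun k => x ^+ 2 ^+ k / (2 * k)`!%:R) n @[n --> \oo] --> cosh x.
Proof.
have E y : series (exp_coeff y) n @[n --> \oo] --> expR y.
  exact: is_cvg_series_exp_coeff.
have dbl : (2 * n)%N @[n --> \oo] --> \oo by apply: cvg_mulnl.
have -> : series (fun k => x ^+ 2 ^+ k / (2 * k)`!%:R) =
    (fun n => (series (exp_coeff x) (2 * n)%N + series (exp_coeff (- x)) (2 * n)%N) * 2^-1).
  apply/funext; elim=> [|n IH].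
    by rewrite /series /= !muln0 !big_geq// addr0 mul0r.
  rewrite /series /= in IH *.
  rewrite big_nat_recr//= IH mulnS !addSn add0n !big_nat_recr//= /exp_coeff /=.
  rewrite -!exprM (exprNn x (2 * n)) (exprNn x (2 * n).+1).
  rewrite -signr_odd -(signr_odd _ _.+1) /= oddM /=.
  have h (u v y z : R) : (u + v) / 2 + y = (u + y + z + (v + y - z)) / 2 by field.
  by rewrite expr0 expr1 mul1r mulN1r mulNr; exact: h.
apply: cvgMr_tmp; apply: cvgD; exact: (cvg_comp _ _ dbl (E _)).
Qed.

Lemma convex_exprn t a b n : 0 <= t -> t <= 1 -> 0 <= a -> 0 <= b ->
  ((1 - t) * a + t * b) ^+ n <= (1 - t) * a ^+ n + t * b ^+ n.
Proof.
move=> t0 t1 a0 b0; elim: n => [|n IH]; first by rewrite !expr0; lra.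
have m0 : 0 <= (1 - t) * a + t * b by rewrite addr_ge0// mulr_ge0// subr_ge0.
rewrite exprS; apply: le_trans (ler_wpM2l m0 IH) _.
rewrite !exprS -subr_ge0.
suff -> : (1 - t) * (a * a ^+ n) + t * (b * b ^+ n) -
    ((1 - t) * a + t * b) * ((1 - t) * a ^+ n + t * b ^+ n) =
    (t * (1 - t)) * ((a - b) * (a ^+ n - b ^+ n)).
  apply: mulr_ge0; first by rewrite mulr_ge0// subr_ge0.
  have [ab|/ltW ab] := leP a b.
    by apply: mulr_le0; rewrite subr_le0// lerXn2r.
  by apply: mulr_ge0; rewrite subr_ge0// lerXn2r.
by ring.
Qed.

(** [cosh] is convex as a function of the square of its argument, because its
    power series in that square has nonnegative coefficients. *)
Lemma cosh_convex_sqr t a b c : 0 <= t -> t <= 1 ->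
  c ^+ 2 = (1 - t) * a ^+ 2 + t * b ^+ 2 ->
  cosh c <= (1 - t) * cosh a + t * cosh b.
Proof.
move=> t0 t1 E.
have CD : (1 - t) * series (fun k => a ^+ 2 ^+ k / (2 * k)`!%:R) n +
    t * series (fun k => b ^+ 2 ^+ k / (2 * k)`!%:R) n @[n --> \oo] -->
    (1 - t) * cosh a + t * cosh b.
  by apply: cvgD; apply: cvgMl_tmp; exact: cvg_cosh_series.
apply: (ler_cvg_to (cvg_cosh_series (x := c)) CD).
apply: nearW => n; rewrite /series /= !mulr_sumr -big_split /=.
apply: ler_sum => k _; rewrite E.
move: (sqr_ge0 a) (sqr_ge0 b); move: (a ^+ 2) (b ^+ 2) => A B A0 B0.
rewrite !mulrA -mulrDl.
by rewrite ler_wpM2r ?invr_ge0 ?ler0n//; apply: convex_exprn.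
Qed.

(** Here [a], [b], [c] and [s] are [|x|], [|d|], [<x, d>] and [|x + d|] for two
    vectors [x] and [d].  For fixed [a] and [b], the left-hand side is convex in
    [c] and the right-hand side is affine, so that it suffices to compare them
    when [x] and [d] are parallel, that is for [s = a + b] and [s = |a - b|].
    The point of this bound is that its last term is linear in [d]: the average
    over a centered [d] kills it. *)
Lemma cosh_norm_increment a b c s : 0 <= a -> 0 <= b -> `|c| <= a * b ->
  s ^+ 2 = a ^+ 2 + 2 * c + b ^+ 2 ->
  cosh s <= cosh a * (expR b - b) + sinh a / a * c.
Proof.
move=> a0 b0 cab sE.
have [ab0|abN0] := eqVneq (a * b) 0.
  have c0 : c = 0 by apply/normr0_eq0/eqP; rewrite eq_le normr_ge0 -{1}ab0 cab.
  have eb : expR b - b = cosh b + (sinh b - b) by rewrite -coshDsinh; ring.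
  have shb := sinh_ge_id b0.
  have cs u : 0 <= u -> s ^+ 2 = u ^+ 2 -> cosh s = cosh u.
    move=> u0 /eqP; rewrite eqf_sqr => /orP[|] /eqP -> //.
    by rewrite /cosh opprK addrC.
  move/eqP: ab0; rewrite mulf_eq0 => /orP[|] /eqP z0.
    rewrite (cs b)// ?sE ?c0 ?z0; last by ring.
    have -> : cosh 0 = 1 :> R by rewrite /cosh oppr0 expR0; field.
    by rewrite eb; lra.
  rewrite (cs a)// ?sE ?c0 ?z0; last by ring.
  by rewrite expR0 subr0; lra.
have ab0 : 0 < a * b by rewrite lt_def abN0 mulr_ge0.
have aN0 : a != 0 by apply: contraNneq abN0 => ->; rewrite mul0r.
have bN0 : b != 0 by apply: contraNneq abN0 => ->; rewrite mulr0.
move: cab; rewrite ler_norml => /andP[c1 c2].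
(* [t] is the barycentric coordinate of [s ^+ 2] between the two extreme
   values [(a - b) ^+ 2] and [(a + b) ^+ 2]. *)
pose t := (c + a * b) / (2 * (a * b)).
have tE : t * (2 * (a * b)) = c + a * b by rewrite /t; field; rewrite ?aN0 ?bN0.
have t0 : 0 <= t by rewrite divr_ge0//; lra.
have t1 : t <= 1 by rewrite ler_pdivrMr; lra.
have E : s ^+ 2 = (1 - t) * (a - b) ^+ 2 + t * (a + b) ^+ 2.
  rewrite sE; suff : 2 * c = 2 * (t * (2 * (a * b))) - 2 * (a * b).
    by move=> ->; ring.
  by rewrite tE; ring.
apply: le_trans (cosh_convex_sqr t0 t1 E) _.
rewrite coshB coshD -coshDsinh.
set u := c / (a * b).
have tu : t = (u + 1) / 2 by rewrite /t /u; field; rewrite ?aN0 ?bN0.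
have uc : sinh a / a * c = sinh a * b * u by rewrite /u; field; rewrite ?aN0 ?bN0.
rewrite uc tu.
have u1 : u <= 1 by rewrite ler_pdivrMr//; lra.
have shb := sinh_ge_id b0.
have sha : 0 <= sinh a by apply: le_trans (sinh_ge_id a0).
rewrite -subr_ge0.
suff -> : cosh a * (cosh b + sinh b - b) + sinh a * b * u -
   ((1 - (u + 1) / 2) * (cosh a * cosh b - sinh a * sinh b) +
   (u + 1) / 2 * (cosh a * cosh b + sinh a * sinh b)) =
   (sinh b - b) * (cosh a - u * sinh a).
  rewrite mulr_ge0 ?subr_ge0//; apply: le_trans (sinh_le_cosh a).
  by rewrite ler_piMl.
by field.
Qed.

End real_inequalities.

(** * Inner products *)

Section inner_product.
Context {R : realType} {V : normedModType R} (dot : {dot V for @idfun R}).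
Hypothesis normE : forall f, `|f| ^+ 2 = dot f f.
Implicit Types x y z : V.

Lemma dotC x y : dot x y = dot y x.
Proof. by rewrite (hermC dot) expr0 mul1r. Qed.

Lemma sqr_normD x y : `|x + y| ^+ 2 = `|x| ^+ 2 + 2 * dot x y + `|y| ^+ 2.
Proof.
by rewrite !normE linearDl /= !linearDr /= (dotC y x); ring.
Qed.

Lemma dotNr x y : dot x (- y) = - dot x y.
Proof. exact: linearNr. Qed.

Lemma sqr_normB x y : `|x - y| ^+ 2 = `|x| ^+ 2 - 2 * dot x y + `|y| ^+ 2.
Proof. by rewrite sqr_normD normrN dotNr; ring. Qed.

Lemma cauchy_schwarz x y : `|dot x y| <= `|x| * `|y|.
Proof.
have h u w : dot u w <= `|u| * `|w|.
  have : `|u + w| ^+ 2 <= (`|u| + `|w|) ^+ 2 by rewrite lerXn2r ?nnegrE ?ler_normD.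
  by rewrite sqr_normD sqrrD -mulr_natl; lra.
rewrite ler_norml h andbT lerNl -dotNr.
by apply: le_trans (h _ _) _; rewrite normrN.
Qed.

Lemma dot_suml (I : finType) (a : I -> R) (c : I -> V) z :
  dot (\sum_i a i *: c i) z = \sum_i a i * dot (c i) z.
Proof.
rewrite linear_sumlz; apply: eq_bigr => i _.
by rewrite linearZl_LR.
Qed.

End inner_product.

(** * Independent sampling from a finite set *)

Section finite_iid.
Context {R : realType} {I : finType} (p : I -> R).
Hypothesis p_ge0 : forall i, 0 <= p i.
Hypothesis p_sum1 : \sum_i p i = 1.

Definition expect n (F : {ffun 'I_n -> I} -> R) : R :=
  \sum_(f : {ffun 'I_n -> I}) (\prod_t p (f t)) * F f.

Definition fcons n (i : I) (f : {ffun 'I_n -> I}) : {ffun 'I_n.+1 -> I} :=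
  [ffun t => oapp f i (unlift ord0 t)].

Lemma fcons0 n i (f : {ffun 'I_n -> I}) : fcons i f ord0 = i.
Proof. by rewrite ffunE unlift_none. Qed.

Lemma fconsS n i (f : {ffun 'I_n -> I}) t : fcons i f (lift ord0 t) = f t.
Proof. by rewrite ffunE liftK. Qed.

Lemma expectS n (F : {ffun 'I_n.+1 -> I} -> R) :
  expect F = \sum_i p i * expect (fun f => F (fcons i f)).
Proof.
rewrite /expect (reindex (fun q : I * {ffun 'I_n -> I} => fcons q.1 q.2)) /=; last first.
  exists (fun g : {ffun 'I_n.+1 -> I} => (g ord0, [ffun t => g (lift ord0 t)])).
    move=> [i f] _ /=; rewrite fcons0; congr pair.
    by apply/ffunP => t; rewrite ffunE fconsS.
  move=> g _ /=; apply/ffunP => t; rewrite ffunE.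
  by case: unliftP => [u|] -> //=; rewrite ffunE.
rewrite -(pair_bigA _ (fun i f => (\prod_t p (fcons i f t)) * F (fcons i f))) /=.
apply: eq_bigr => i _; rewrite mulr_sumr; apply: eq_bigr => f _.
rewrite big_ord_recl fcons0 mulrA; congr (_ * _ * _).
by apply: eq_bigr => t _; rewrite fconsS.
Qed.

Lemma expect0 (F : {ffun 'I_0 -> I} -> R) c : (forall f, F f = c) -> expect F = c.
Proof.
move=> Fc; rewrite /expect.
transitivity (\sum_(f : {ffun 'I_0 -> I}) c).
  by apply: eq_bigr => f _; rewrite big_ord0 mul1r Fc.
by rewrite sumr_const card_ffun card_ord expn0.
Qed.

Lemma ler_expect n (F G : {ffun 'I_n -> I} -> R) :
  (forall f, F f <= G f) -> expect F <= expect G.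
Proof.
move=> FG; apply: ler_sum => f _.
by rewrite ler_wpM2l// prodr_ge0.
Qed.

Lemma eq_expect n (F G : {ffun 'I_n -> I} -> R) : F =1 G -> expect F = expect G.
Proof. by move=> FG; apply: eq_bigr => f _; rewrite FG. Qed.

Lemma expectD n (F G : {ffun 'I_n -> I} -> R) :
  expect (fun f => F f + G f) = expect F + expect G.
Proof. by rewrite -big_split; apply: eq_bigr => f _; rewrite mulrDr. Qed.

Lemma expectZ n a (F : {ffun 'I_n -> I} -> R) : expect (fun f => a * F f) = a * expect F.
Proof. by rewrite mulr_sumr; apply: eq_bigr => f _; rewrite mulrCA. Qed.

Lemma expect_sum n (J : finType) (F : J -> {ffun 'I_n -> I} -> R) :
  expect (fun f => \sum_j F j f) = \sum_j expect (F j).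
Proof.
rewrite exchange_big; apply: eq_bigr => f _ /=.
by rewrite mulr_sumr.
Qed.

Lemma expect1 n : expect (fun _ : {ffun 'I_n -> I} => 1) = 1.
Proof.
elim: n => [|n IH]; first exact: expect0.
by rewrite expectS -[RHS]p_sum1; apply: eq_bigr => i _; rewrite IH mulr1.
Qed.

Lemma expect_perm n (s : {perm 'I_n}) (F : {ffun 'I_n -> I} -> R) :
  expect (fun f => F [ffun t => f (s t)]) = expect F.
Proof.
rewrite /expect [RHS](reindex (fun f : {ffun 'I_n -> I} => [ffun t => f (s t)])) /=.
  apply: eq_bigr => f _; congr (_ * _).
  rewrite (reindex_perm s) /=; by apply: eq_bigr => t _; rewrite ffunE.
exists (fun f : {ffun 'I_n -> I} => [ffun t => f (s^-1%g t)]) => f _;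
  by apply/ffunP => t; rewrite !ffunE ?permKV ?permK.
Qed.

(** The pairs of Hoeffding's decomposition are indexed by [2 * j] and
    [(2 * j).+1]; coordinates with an index in [nat] spare the bound proofs in
    inductions on the size of the sample. *)
Definition coord_or (i0 : I) n (f : {ffun 'I_n -> I}) (j : nat) : I :=
  oapp f i0 (insub j).

Lemma coord_orE i0 n (f : {ffun 'I_n -> I}) (t : 'I_n) : coord_or i0 f t = f t.
Proof. by rewrite /coord_or valK. Qed.

Lemma coord_or_fcons0 i0 n i (f : {ffun 'I_n -> I}) : coord_or i0 (fcons i f) 0 = i.
Proof. by rewrite -[0%N]/(nat_of_ord (@ord0 n)) coord_orE fcons0. Qed.

Lemma coord_or_fconsS i0 n i (f : {ffun 'I_n -> I}) j :
  coord_or i0 (fcons i f) j.+1 = coord_or i0 f j.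
Proof.
have [jn|nj] := ltnP j n.
  by rewrite -[j]/(nat_of_ord (Ordinal jn)) coord_orE -(fconsS i) -(coord_orE i0) lift0.
by rewrite /coord_or !insubF// ltnNge ?ltnS nj.
Qed.

(** Disjoint pairs of coordinates are independent and identically distributed. *)
Lemma expect_pairs i0 m n (G : I -> I -> R) : (2 * m <= n)%N ->
  expect (fun f : {ffun 'I_n -> I} =>
        \prod_(j < m) G (coord_or i0 f (2 * j)) (coord_or i0 f (2 * j).+1)) =
  (\sum_i \sum_j p i * p j * G i j) ^+ m.
Proof.
elim: m n => [|m IH] n mn.
  under eq_expect do rewrite big_ord0.
  by rewrite expr0 expect1.
case: n mn => [|[|n]] mn; [lia|lia|].
rewrite expectS exprS mulr_suml; apply: eq_bigr => i _.
rewrite expectS mulr_sumr mulr_suml; apply: eq_bigr => j _.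
rewrite -(IH n); last by lia.
rewrite mulrA -[RHS]mulrA; congr (_ * _).
rewrite -expectZ; apply: eq_expect => f; rewrite big_ord_recl.
rewrite muln0 coord_or_fcons0 coord_or_fconsS coord_or_fcons0; congr (_ * _).
by apply: eq_bigr => k _; rewrite lift0 mulnS !addSn add0n !coord_or_fconsS.
Qed.

End finite_iid.

(** * Averaging over permutations *)

Lemma card_neq n (t : 'I_n) : #|[pred u | t != u]| = n.-1.
Proof.
rewrite -[n in RHS]card_ord -(cardC1 t); apply: eq_card => u.
by rewrite !inE eq_sym.
Qed.

(** The permutation group is transitive on pairs of distinct indices, so the
    left-hand sum does not depend on the pair [(a, b)]; averaging over all
    pairs gives the right-hand side. *)
Lemma sum_perm_pair (R : realType) n (H : 'I_n -> 'I_n -> R) (a b : 'I_n) : a != b ->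
  (n * n.-1)%:R * \sum_(s : {perm 'I_n}) H (s a) (s b) =
  #|{perm 'I_n}|%:R * \sum_t \sum_(u | t != u) H t u.
Proof.
move=> ab.
pose C a b : R := \sum_(s : {perm 'I_n}) H (s a) (s b).
have CE a' b' : a' != b' -> C a' b' = C a b.
  move=> ab'; rewrite /C.
  pose x := tperm a a' b.
  pose tau := (tperm a a' * tperm x b')%g.
  have xa' : x != a'.
    by rewrite /x -{2}(tpermL a a') (inj_eq perm_inj) eq_sym.
  have ta : tau a = a' by rewrite permM tpermL tpermD// eq_sym.
  have tb : tau b = b' by rewrite permM tpermL.
  rewrite [RHS](reindex_inj (mulgI tau)); apply: eq_bigr => s _.
  by rewrite !(permM tau) ta tb.
transitivity (\sum_t \sum_(u | t != u) C t u).
  rewrite [RHS](eq_bigr (fun=> (n.-1)%:R * C a b)).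
    by rewrite sumr_const card_ord -[RHS]mulr_natl natrM mulrA.
  move=> t _; rewrite (eq_bigr (fun=> C a b)); last by move=> u /CE.
  by rewrite sumr_const card_neq mulr_natl.
under eq_bigr do rewrite exchange_big.
rewrite exchange_big /=.
transitivity (\sum_(s : {perm 'I_n}) \sum_t \sum_(u | t != u) H t u).
  apply: eq_bigr => s _.
  rewrite [RHS](reindex_perm s) /=; apply: eq_bigr => t _.
  rewrite [RHS](reindex_perm s) /=; apply: eq_bigl => u.
  by rewrite (inj_eq perm_inj).
by rewrite sumr_const mulr_natl.
Qed.

(** Jensen's inequality for the uniform law on [J]. *)
Lemma expR_mean_le (R : realType) (J : finType) (y : J -> R) : (0 < #|J|)%N ->
  expR (#|J|%:R^-1 * \sum_j y j) <= #|J|%:R^-1 * \sum_j expR (y j).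
Proof.
move=> J0; set a := _ * _.
have N0 : #|J|%:R != 0 :> R by rewrite pnatr_eq0 -lt0n.
have aE : \sum_j y j = #|J|%:R * a by rewrite /a mulrA mulfV// mul1r.
rewrite ler_pdivlMl ?ltr0n//.
have -> : #|J|%:R * expR a = \sum_j expR a * (1 + (y j - a)).
  rewrite -mulr_sumr mulrC; congr (_ * _).
  by rewrite big_split /= sumrB aE !sumr_const (mulr_natl a) subrr addr0.
apply: ler_sum => j _.
rewrite -[X in _ <= expR X](subrK a) expRD mulrC ler_pM2r ?expR_gt0//.
exact: expR_ge1Dx.
Qed.

(** * Concentration for finitely valued samples *)

Lemma sqrt_le_of_sqr (R : realType) (x y : R) : 0 <= y -> x <= y ^+ 2 -> Num.sqrt x <= y.
Proof. by move=> y0 xy; rewrite -[y]ger0_norm// -sqrtr_sqr ler_wsqrtr. Qed.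

Lemma le_sqrt_of_sqr (R : realType) (x y : R) : 0 <= y -> y ^+ 2 <= x -> y <= Num.sqrt x.
Proof. by move=> y0 xy; rewrite -[leLHS]ger0_norm// -sqrtr_sqr ler_wsqrtr. Qed.

(** Choice of the exponent in Chernoff's method: for [w > 0] the usual rate is
    [s / (1 + M s)] with [s = sqrt (2 L / w)].  It already works with factor
    1 instead of [5/4]; the margin is what allows a rate below [1 / M] when
    [w = 0]. *)
Lemma exists_bernstein_rate (R : realType) (w M L : R) : 0 <= w -> 0 < M -> 0 <= L ->
  exists l, [/\ 0 <= l, l * M < 1 &
    L + w * (l ^+ 2 / (2 * (1 - l * M))) <=
    l * (Num.sqrt (2 * w * L) + 5 / 4 * (M * L))].
Proof.
move=> w0 M0 L0; have [->|wN0] := eqVneq w 0.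
  exists (4 / 5 / M); split; first by rewrite divr_ge0// ltW.
    by rewrite divfK ?gt_eqF//; lra.
  rewrite mul0r addr0 mulr0 mul0r sqrtr0 add0r.
  have -> : 4 / 5 / M * (5 / 4 * (M * L)) = L by field; rewrite gt_eqF.
  by [].
have {}w0 : 0 < w by rewrite lt_def wN0.
pose s := Num.sqrt (2 * L / w).
have s0 : 0 <= s by exact: sqrtr_ge0.
have s2 : s ^+ 2 = 2 * L / w by rewrite sqr_sqrtr// divr_ge0 ?mulr_ge0 ?(ltW w0).
have ws : w * s ^+ 2 = 2 * L by rewrite s2; field.
have E : w * s <= Num.sqrt (2 * w * L).
  apply: le_sqrt_of_sqr; first by rewrite mulr_ge0// ltW.
  by rewrite exprMn expr2 -mulrA ws; lra.
have Ms0 : 0 <= M * s by rewrite mulr_ge0// ltW.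
have q0 : 0 < 1 + M * s by lra.
have qN0 : 1 + M * s != 0 by rewrite gt_eqF.
exists (s / (1 + M * s)); split; first by rewrite divr_ge0// ltW.
  by rewrite mulrAC ltr_pdivrMr// mulrC; lra.
have -> : 1 - s / (1 + M * s) * M = (1 + M * s)^-1 by field.
have -> : L + w * ((s / (1 + M * s)) ^+ 2 / (2 * (1 + M * s)^-1)) =
    s / (1 + M * s) * (w * s + M * L).
  have -> : w * ((s / (1 + M * s)) ^+ 2 / (2 * (1 + M * s)^-1)) =
    (w * s ^+ 2) / (2 * (1 + M * s)) by field.
  have -> : s / (1 + M * s) * (w * s + M * L) =
    (w * s ^+ 2 + M * s * L) / (1 + M * s) by field.
  by rewrite ws; field.
rewrite ler_wpM2l ?divr_ge0 ?(ltW q0)//; apply: lerD => //.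
have : 0 <= M * L by rewrite mulr_ge0// ltW.
by lra.
Qed.

Definition empirical_variance (R : realType) (V : normedModType R) n (x : 'I_n -> V) : R :=
  ((n%:R - 1) * n%:R)^-1 * \sum_t \sum_(s | t != s) (`|x t - x s| ^+ 2 / 2).

Section concentration.
Context {R : realType} {V : normedModType R} (dot : {dot V for @idfun R}).
Hypothesis normE : forall f, `|f| ^+ 2 = dot f f.
Context {I : finType} (p : I -> R).
Hypothesis p_ge0 : forall i, 0 <= p i.
Hypothesis p_sum1 : \sum_i p i = 1.
Local Notation expect := (expect p).

(** Induction on [n], with the first point of the sample averaged last: over
    that point, [cosh_norm_increment] costs one factor, its linear term being
    killed by the centering of [xi]. *)
Lemma expect_cosh_norm_sum n x (xi : I -> V) : \sum_i p i *: xi i = 0 ->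
  expect (fun f : {ffun 'I_n -> I} => cosh `|x + \sum_t xi (f t)|) <=
  cosh `|x| * (\sum_i p i * (expR `|xi i| - `|xi i|)) ^+ n.
Proof.
move=> xi0; set G := \sum_i _.
have G0 : 0 <= G.
  apply: sumr_ge0 => i _; rewrite mulr_ge0// subr_ge0.
  by apply: le_trans (expR_ge1Dx _); rewrite lerDr.
elim: n x => [|n IH] x.
  by rewrite expr0 mulr1 (expect0 _ (c := cosh `|x|))// => f; rewrite big_ord0 addr0.
rewrite expectS.
apply: (@le_trans _ _ (\sum_i p i * (cosh `|x + xi i| * G ^+ n))).
  apply: ler_sum => i _; rewrite ler_wpM2l//; apply: le_trans (IH _).
  rewrite le_eqVlt; apply/orP; left; apply/eqP/eq_expect => f.
  rewrite big_ord_recl fcons0 addrA; congr (cosh `|_ + _|).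
  by apply: eq_bigr => t _; rewrite fconsS.
rewrite exprS mulrA; under eq_bigr do rewrite mulrA.
rewrite -mulr_suml ler_wpM2r ?exprn_ge0//.
pose K := sinh `|x| / `|x|.
apply: (@le_trans _ _ (\sum_i p i * (cosh `|x| * (expR `|xi i| - `|xi i|) + K * dot x (xi i)))).
  apply: ler_sum => i _; rewrite ler_wpM2l//.
  apply: cosh_norm_increment; rewrite ?normr_ge0 ?cauchy_schwarz//.
  exact: sqr_normD.
under eq_bigr do rewrite mulrDr (mulrCA (p _)) (mulrCA (p _) K) (dotC dot x).
by rewrite big_split /= -!mulr_sumr -dot_suml xi0 linear0l mulr0 addr0.
Qed.

Variable c : I -> V.
Local Notation mu := (\sum_i p i *: c i).
Local Notation var := (\sum_i p i * `|c i - mu| ^+ 2).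
Local Notation h i j := (`|c i - c j| ^+ 2 / 2).

Lemma sum_centered : \sum_i p i *: (c i - mu) = 0.
Proof.
under eq_bigr do rewrite scalerBr.
by rewrite sumrB -scaler_suml p_sum1 scale1r subrr.
Qed.

Lemma var_ge0 : 0 <= var.
Proof. by apply: sumr_ge0 => i _; rewrite mulr_ge0 ?sqr_ge0. Qed.

(** The variance is the mean of half the squared distance between two independent
    points, which is why the U-statistic below is unbiased. *)
Lemma var_pairs : \sum_i \sum_j p i * p j * h i j = var.
Proof.
set m := mu; set v := RHS.
have hE i j : h i j = `|c i - m| ^+ 2 / 2 + `|c j - m| ^+ 2 / 2 - dot (c j - m) (c i - m).
  have -> : c i - c j = (c i - m) - (c j - m) by rewrite opprB addrA subrK.
  by rewrite (sqr_normB normE) (dotC dot (c i - m)); field.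
transitivity (\sum_i (p i * `|c i - m| ^+ 2 / 2 + p i * (v / 2))).
  apply: eq_bigr => i _.
  have E j : p i * p j * h i j = (p i * (`|c i - m| ^+ 2 / 2)) * p j +
      (p i / 2) * (p j * `|c j - m| ^+ 2) - p i * (p j * dot (c j - m) (c i - m)).
    by rewrite hE; ring.
  rewrite (eq_bigr _ (fun j _ => E j)) sumrB big_split /= -!mulr_sumr p_sum1.
  by rewrite -dot_suml sum_centered linear0l -/v; ring.
by rewrite big_split /= -!mulr_suml p_sum1 mul1r -/v; field.
Qed.

Variable D : R.
Hypothesis hD : forall i j, h i j <= D.

Lemma norm_centered_le i : `|c i - mu| <= Num.sqrt (2 * D).
Proof.
have -> : c i - mu = \sum_j p j *: (c i - c j).
  under [RHS]eq_bigr do rewrite scalerBr.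
  by rewrite sumrB -scaler_suml p_sum1 scale1r.
apply: le_trans (ler_norm_sum _ _ _) _.
rewrite -[leRHS]mul1r -[X in _ <= X * _]p_sum1 mulr_suml; apply: ler_sum => j _.
rewrite normrZ ger0_norm// ler_wpM2l// le_sqrt_of_sqr//.
by have := hD i j; lra.
Qed.

(** Chernoff's method with [cosh] in place of the exponential, which is what
    makes the bound independent of the dimension; [expR x <= 2 * cosh x] is the
    origin of the factor 2. *)
Lemma hilbert_bernstein_tail n L : 0 < D -> 0 <= L ->
  expect (fun f : {ffun 'I_n -> I} =>
    (Num.sqrt (2 * (n%:R * var) * L) + 5 / 4 * (Num.sqrt (2 * D) * L)
      < `|\sum_t (c (f t) - mu)|)%R%:R) <= 2 * expR (- L).
Proof.
move=> D0 L0; set r := _ + _; set M := Num.sqrt (2 * D) in r *.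
have M0 : 0 < M by rewrite sqrtr_gt0 mulr_gt0.
have w0 : 0 <= n%:R * var by rewrite mulr_ge0 ?var_ge0 ?ler0n.
have [l [l0 lM lr]] := exists_bernstein_rate w0 M0 L0.
pose xi i := l *: (c i - mu).
have xi0 : \sum_i p i *: xi i = 0.
  under eq_bigr do rewrite scalerA mulrC -scalerA.
  by rewrite -scaler_sumr sum_centered scaler0.
have q0 : 0 < 1 - l * M by lra.
pose Q := l ^+ 2 / (2 * (1 - l * M)).
have GQ : \sum_i p i * (expR `|xi i| - `|xi i|) <= expR (var * Q).
  apply: (@le_trans _ _ (1 + var * Q)); last exact: expR_ge1Dx.
  have -> : 1 + var * Q = \sum_i p i * (1 + `|c i - mu| ^+ 2 * Q).
    under [RHS]eq_bigr do rewrite mulrDr mulr1 mulrA.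
    by rewrite big_split /= p_sum1 mulr_suml.
  apply: ler_sum => i _; rewrite ler_wpM2l//.
  have -> : `|xi i| = l * `|c i - mu| by rewrite normrZ ger0_norm.
  set y := l * _.
  have y0 : 0 <= y by rewrite mulr_ge0.
  have yM : y <= l * M by rewrite ler_wpM2l ?norm_centered_le.
  have -> : `|c i - mu| ^+ 2 * Q = y ^+ 2 / (2 * (1 - l * M)).
    by rewrite /Q /y; field; rewrite gt_eqF.
  have B := expR_le_bernstein y0.
  have E : expR y - y - 1 <= y ^+ 2 / (2 * (1 - y)).
    by rewrite ler_pdivlMr; nra.
  suff : y ^+ 2 / (2 * (1 - y)) <= y ^+ 2 / (2 * (1 - l * M)) by lra.
  by rewrite ler_wpM2l ?sqr_ge0// lef_pV2 ?posrE; lra.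
have G0 : 0 <= \sum_i p i * (expR `|xi i| - `|xi i|).
  apply: sumr_ge0 => i _; rewrite mulr_ge0// subr_ge0.
  by apply: le_trans (expR_ge1Dx _); rewrite lerDr.
have := @expect_cosh_norm_sum n 0 xi xi0.
rewrite normr0 {2}/cosh oppr0 expR0 -[1 + 1]/2 divff// mul1r => EC.
apply: (@le_trans _ _ (expect (fun f : {ffun 'I_n -> I} =>
    2 * expR (- (l * r)) * cosh `|0 + \sum_t xi (f t)|))).
  apply: ler_expect => // f.
  have -> : `|0 + \sum_t xi (f t)| = l * `|\sum_t (c (f t) - mu)|.
    by rewrite add0r -scaler_sumr normrZ ger0_norm.
  set S := `|_|; have [rS|_] := ltP r S; last first.
    by rewrite mulr_ge0 ?(ltW (cosh_gt0 _))// mulr_ge0 ?expR_ge0.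
  have lrS : 0 <= - (l * r) + l * S.
    by rewrite addrC -mulrBr mulr_ge0// subr_ge0 ltW.
  have : 1 <= expR (- (l * r)) * expR (l * S).
    by rewrite -expRD -[1]expR0 ler_expR.
  rewrite /cosh /=.
  have : 0 <= expR (- (l * r)) * expR (- (l * S)) by rewrite mulr_ge0 ?expR_ge0.
  by lra.
rewrite expectZ -mulrA ler_wpM2l//.
apply: (@le_trans _ _ (expR (- (l * r)) * expR (n%:R * (var * Q)))).
  rewrite ler_wpM2l ?expR_ge0//; apply: le_trans EC _.
  by rewrite expRM_natl lerXn2r ?nnegrE ?expR_ge0.
rewrite -expRD ler_expR mulrA.
by move: lr; rewrite -/r -/Q; lra.
Qed.

Local Notation ustat f := (empirical_variance (fun t => c (f t))).

Lemma h_ge0 i j : 0 <= h i j.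
Proof. by rewrite divr_ge0 ?sqr_ge0. Qed.

Lemma empirical_variance_ge0 n (f : {ffun 'I_n -> I}) : 0 <= ustat f.
Proof.
case: n f => [|n] f; first by rewrite /empirical_variance mulr0 invr0 mul0r.
apply: mulr_ge0.
  by rewrite invr_ge0 mulr_ge0// subr_ge0 ler1n.
by apply: sumr_ge0 => t _; apply: sumr_ge0 => s _; exact: h_ge0.
Qed.

(** Hoeffding's decomposition: the U-statistic is the average over the
    permutations [s] of the mean of [h] over the [n./2] disjoint pairs
    [(s (2 j), s (2 j + 1))].  By convexity of the exponential it suffices to
    bound the Laplace transform of such a mean of independent terms, for which
    [0 <= h <= D] gives a second moment at most [D * var]. *)
Lemma expect_expRN_empirical_variance n l : (2 <= n)%N -> 0 <= l ->
  expect (fun f : {ffun 'I_n -> I} => expR (- (l * ustat f))) <=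
  expR (- (l * var) + l ^+ 2 * D * var / (2 * (n./2)%:R)).
Proof.
move=> n2 l0; set m := n./2.
have m0 : (0 < m)%N by rewrite /m; lia.
have mn : (2 * m <= n)%N by rewrite /m; lia.
have mR : 0 < m%:R :> R by rewrite ltr0n.
have n0 : (0 < n)%N by lia.
have [i0 _] : exists i : I, True.
  have [/existsP[i _]|/existsPn E] := boolP [exists i : I, true]; first by exists i.
  exfalso; have := p_sum1; rewrite big1 => [/eqP|i]; last by have := E i.
  by rewrite eq_sym oner_eq0.
have lt1 (j : 'I_m) : (2 * j < n)%N by have := ltn_ord j; lia.
have lt2 (j : 'I_m) : ((2 * j).+1 < n)%N by have := ltn_ord j; lia.
pose k := l / m%:R.
have k0 : 0 <= k by rewrite divr_ge0// ler0n.
pose g i j := expR (- (k * h i j)).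
pose sh (s : {perm 'I_n}) (f : {ffun 'I_n -> I}) := [ffun t => f (s t)].
pose W (f : {ffun 'I_n -> I}) :=
  \prod_(j < m) g (coord_or i0 f (2 * j)) (coord_or i0 f (2 * j).+1).
pose N := #|{perm 'I_n}|.
have N0 : (0 < N)%N by apply/card_gt0P; exists 1%g.
have NR : N%:R != 0 :> R by rewrite pnatr_eq0 -lt0n.
have nR : n%:R != 0 :> R by rewrite pnatr_eq0 -lt0n.
have n1R : n%:R - 1 != 0 :> R by rewrite subr_eq0 (eqr_nat _ _ 1); lia.
have WE (f : {ffun 'I_n -> I}) :
    expR (- (l * ustat f)) <= N%:R^-1 * \sum_(s : {perm 'I_n}) W (sh s f).
  pose y (s : {perm 'I_n}) : R := - (k * \sum_(j < m)
     h (f (s (Ordinal (lt1 j)))) (f (s (Ordinal (lt2 j))))).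
  have WsE s : W (sh s f) = expR (y s).
    rewrite /y mulr_sumr -sumrN expR_sum; apply: eq_bigr => j _.
    rewrite -[X in g (coord_or _ _ X)]/(nat_of_ord (Ordinal (lt1 j))).
    rewrite -[X in g _ (coord_or _ _ X)]/(nat_of_ord (Ordinal (lt2 j))).
    by rewrite !coord_orE !ffunE.
  under eq_bigr do rewrite WsE.
  have -> : - (l * ustat f) = N%:R^-1 * \sum_s y s; last exact: expR_mean_le.
  rewrite /y sumrN -mulr_sumr exchange_big /=.
  have E (j : 'I_m) :
      \sum_(s : {perm 'I_n}) h (f (s (Ordinal (lt1 j)))) (f (s (Ordinal (lt2 j)))) =
      N%:R * ustat f.
    have := @sum_perm_pair R n (fun t u => h (f t) (f u))
      (Ordinal (lt1 j)) (Ordinal (lt2 j)).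
    have jj : Ordinal (lt1 j) != Ordinal (lt2 j).
      by rewrite -val_eqE /= neq_ltn leqnn.
    move=> /(_ jj); rewrite -/N natrM -subn1 natrB// => /= E.
    apply: (mulfI (mulf_neq0 nR n1R)); rewrite E /empirical_variance mulrCA; congr (_ * _).
    by rewrite mulrA (mulrC n%:R) mulfV ?mul1r// mulf_neq0.
  rewrite (eq_bigr (fun=> N%:R * ustat f))// sumr_const card_ord -mulr_natl.
  rewrite /k; field; rewrite NR.
  by rewrite gt_eqF.
apply: le_trans (ler_expect p_ge0 WE) _.
rewrite expectZ expect_sum.
have EW s : expect (fun f => W (sh s f)) = (\sum_i \sum_j p i * p j * g i j) ^+ m.
  by rewrite /sh (expect_perm p s W) /W expect_pairs.
rewrite (eq_bigr _ (fun s _ => EW s)) sumr_const -/N.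
rewrite -[X in _ * X]mulr_natl mulrA mulVf// mul1r.
pose e := - (k * var) + k ^+ 2 * D * var / 2.
have ge i j : g i j <= 1 + (- k + k ^+ 2 * D / 2) * h i j.
  apply: le_trans (expRN_le_quadratic _) _; first by rewrite mulr_ge0// h_ge0.
  have : h i j * h i j <= D * h i j by rewrite ler_wpM2r ?h_ge0.
  move: (h i j) => z zD; rewrite exprMn expr2.
  have : k ^+ 2 * (z * z) <= k ^+ 2 * (D * z) by rewrite ler_wpM2l ?sqr_ge0.
  by rewrite expr2; lra.
have G0 : 0 <= \sum_i \sum_j p i * p j * g i j.
  by apply: sumr_ge0 => i _; apply: sumr_ge0 => j _; rewrite !mulr_ge0 ?expR_ge0.
have Ge : \sum_i \sum_j p i * p j * g i j <= expR e.
  apply: (@le_trans _ _ (1 + e)); last exact: expR_ge1Dx.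
  have -> : 1 + e = \sum_i \sum_j p i * p j * (1 + (- k + k ^+ 2 * D / 2) * h i j).
    have E i j : p i * p j * (1 + (- k + k ^+ 2 * D / 2) * h i j) =
      p i * p j + (- k + k ^+ 2 * D / 2) * (p i * p j * h i j) by ring.
    under eq_bigr do under eq_bigr do rewrite E.
    under eq_bigr do rewrite big_split /= -!mulr_sumr p_sum1 mulr1.
    by rewrite big_split /= p_sum1 -mulr_sumr var_pairs /e; ring.
  apply: ler_sum => i _; apply: ler_sum => j _.
  by rewrite ler_wpM2l ?mulr_ge0.
apply: (@le_trans _ _ (expR e ^+ m)); first by rewrite lerXn2r ?nnegrE ?expR_ge0.
rewrite -expRM_natl ler_expR /e /k le_eqVlt; apply/orP; left; apply/eqP.
by field; rewrite gt_eqF.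
Qed.

(** The previous bound makes [var] exceed the sample variance by at most
    [sqrt var * b] with the required probability, where [b] is the square root of
    [6 * D * L / n]; solving this quadratic inequality in [sqrt var] gives a
    bound that does not involve [var].  The constant 6 comes from
    [n / 3 <= n./2]. *)
Lemma empirical_variance_lower_tail n L : (2 <= n)%N -> 0 <= L ->
  expect (fun f : {ffun 'I_n -> I} =>
    (Num.sqrt (ustat f) + Num.sqrt (6 * D * L / n%:R) < Num.sqrt var)%R%:R)
  <= expR (- L).
Proof.
move=> n2 L0; set b := Num.sqrt (6 * D * L / n%:R).
have [m0 m3] : (0 < n./2)%N /\ (n <= 3 * n./2)%N by split; lia.
have nR : 0 < n%:R :> R by rewrite ltr0n; lia.
have b0 : 0 <= b by exact: sqrtr_ge0.
have v0 := var_ge0.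
have triv F : (forall f, F f = false) ->
    expect (fun f : {ffun 'I_n -> I} => (F f)%:R) <= expR (- L).
  move=> FF; rewrite (eq_expect _ (G := fun=> 0 * 1)); last by move=> f; rewrite FF mul0r.
  by rewrite expectZ mul0r expR_ge0.
have [ve|vN0] := eqVneq var 0.
  by apply: triv => f; apply/negbTE; rewrite -leNgt ve sqrtr0 addr_ge0 ?sqrtr_ge0.
have {}v0 : 0 < var by rewrite lt_def vN0.
have D0 : 0 < D.
  rewrite ltNge; apply/negP => D0; move: v0; rewrite ltNge -var_pairs => /negP; apply.
  apply: sumr_le0 => i _; apply: sumr_le0 => j _.
  by rewrite mulr_ge0_le0 ?mulr_ge0//; exact: le_trans D0.
set q := Num.sqrt var.
have q0 : 0 < q by rewrite sqrtr_gt0.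
have q2 : q ^+ 2 = var by rewrite sqr_sqrtr ?(ltW v0).
have b2 : b ^+ 2 = 6 * D * L / n%:R.
  by rewrite sqr_sqrtr// divr_ge0 ?ler0n// !mulr_ge0 ?(ltW D0).
(* The minimizer of the Chernoff exponent, with [n / 3] in place of [n./2]. *)
pose l := b * n%:R / (3 * D * q).
have l0 : 0 <= l by rewrite divr_ge0 ?mulr_ge0 ?ler0n ?(ltW D0) ?(ltW q0).
apply: (@le_trans _ _ (expect (fun f : {ffun 'I_n -> I} =>
    expR (l * var - l * (q * b)) * expR (- (l * ustat f))))).
  apply: ler_expect => // f; rewrite -expRD; case: ltP => [bq|_]; last exact: expR_ge0.
  rewrite /= -[1%:R]expR0 ler_expR.
  have u0 := sqrtr_ge0 (ustat f).
  have u2 : Num.sqrt (ustat f) ^+ 2 = ustat f by rewrite sqr_sqrtr ?empirical_variance_ge0.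
  suff : 0 <= l * (var - q * b - ustat f) by lra.
  rewrite mulr_ge0// -u2 -q2; nra.
rewrite expectZ; apply: le_trans (ler_wpM2l (expR_ge0 _) (expect_expRN_empirical_variance n2 l0)) _.
rewrite -expRD ler_expR.
set m := n./2 in m0 m3 *.
have mR : 0 < m%:R :> R by rewrite ltr0n.
have mn : n%:R <= 3 * m%:R :> R by rewrite -natrM ler_nat.
have l1 : l * (q * b) = 2 * L.
  have -> : l * (q * b) = b ^+ 2 * n%:R / (3 * D) by rewrite /l; field; rewrite !gt_eqF.
  by rewrite b2; field; rewrite !gt_eqF.
have l2 : l ^+ 2 * D * var = 2 / 3 * L * n%:R.
  have -> : l ^+ 2 * D * var = b ^+ 2 * n%:R ^+ 2 / (9 * D).
    by rewrite /l -q2; field; rewrite !gt_eqF.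
  by rewrite b2; field; rewrite !gt_eqF.
rewrite l1 l2.
suff : 2 / 3 * L * n%:R / (2 * m%:R) <= L by lra.
rewrite ler_pdivrMr ?mulr_gt0//.
have := ler_wpM2l L0 mn; lra.
Qed.

End concentration.

Section combination.
Context {R : realType} {V : normedModType R} (dot : {dot V for @idfun R}).
Hypothesis normE : forall f, `|f| ^+ 2 = dot f f.
Context {I : finType} (p : I -> R).
Hypothesis p_ge0 : forall i, 0 <= p i.
Hypothesis p_sum1 : \sum_i p i = 1.
Variables (c : I -> V) (D : R).
Local Notation mu := (\sum_i p i *: c i).
Hypothesis hD : forall i j, `|c i - c j| ^+ 2 / 2 <= D.

Local Notation ustat f := (empirical_variance (fun t => c (f t))).

(** The two tails use up [3 / 4] of [delta], and the constants fit because
    [7 / 2] bounds [sqrt 12], [10 / 7] bounds [sqrt 2], and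
    [7 / 2 + 5 / 4 * (10 / 7)] is less than [16 / 3]. *)
Lemma finite_empirical_bernstein n delta : (2 <= n)%N -> 0 < delta -> delta < 1 -> 0 <= D ->
  expect p (fun f : {ffun 'I_n -> I} =>
    (Num.sqrt (2 * ustat f * (ln (4 / delta) / n%:R))
         + 16 / 3 * Num.sqrt D * (ln (4 / delta) / n%:R) <
     `|n%:R^-1 *: \sum_t c (f t) - mu|)%R%:R) <= delta.
Proof.
move=> n2 d0 d1 D0.
have nR : 0 < n%:R :> R by rewrite ltr0n; lia.
have nN0 : n%:R != 0 :> R by rewrite gt_eqF.
pose L := ln (4 / delta); rewrite -/L.
have L0 : 0 <= L by rewrite ln_ge0// ler_pdivlMr//; lra.
have eL : expR (- L) = delta / 4 by rewrite expRN lnK ?posrE ?divr_gt0// invf_div.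
pose l := L / n%:R; rewrite -/l.
have l0 : 0 <= l by rewrite divr_ge0 ?ler0n.
have Ll : L = n%:R * l by rewrite /l mulrC divfK.
have dev (f : {ffun 'I_n -> I}) :
    `|n%:R^-1 *: \sum_t c (f t) - mu| * n%:R = `|\sum_t (c (f t) - mu)|.
  rewrite sumrB sumr_const card_ord -[X in _ = `|_ - X|]scaler_nat.
  have -> : n%:R^-1 *: \sum_t c (f t) - mu =
      n%:R^-1 *: (\sum_t c (f t) - n%:R *: mu).
    by rewrite scalerBr scalerA mulVf// scale1r.
  by rewrite normrZ ger0_norm ?invr_ge0 ?ler0n// mulrC mulrA mulfV// mul1r.
have [Dz|DN0] := eqVneq D 0.
  have cE i : c i - mu = 0.
    apply/eqP; rewrite -normr_le0; apply: le_trans (norm_centered_le p_ge0 p_sum1 hD i) _.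
    by rewrite Dz mulr0 sqrtr0.
  rewrite (eq_expect _ (G := fun=> 0 * 1)).
    by rewrite expectZ mul0r ltW.
  move=> f; rewrite mul0r; apply/eqP; rewrite pnatr_eq0 eqb0 -leNgt.
  have -> : `|n%:R^-1 *: \sum_t c (f t) - mu| = 0.
    apply: (mulIf nN0); rewrite dev mul0r big1 ?normr0// => t _.
  by rewrite addr_ge0 ?sqrtr_ge0// !mulr_ge0 ?sqrtr_ge0.
have {}D0 : 0 < D by rewrite lt_def DN0.
have T1 := @hilbert_bernstein_tail R V dot normE I p p_ge0 p_sum1 c D hD n L D0 L0.
have T2 := @empirical_variance_lower_tail R V dot normE I p p_ge0 p_sum1 c D hD n L n2 L0.
apply: (@le_trans _ _ (2 * expR (- L) + expR (- L))); last by rewrite eL; lra.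
apply: le_trans (lerD T1 T2); rewrite -expectD; apply: ler_expect => // f.
case: ltP => [bad|_]; last by rewrite addr_ge0 ?ler0n.
set var := \sum_i _ in T1 T2 *; set u := ustat f in bad *.
rewrite -natrD ler_nat -(leq_add2r 0) addn0.
have v0 : 0 <= var by exact: var_ge0.
have u0 : 0 <= u by exact: empirical_variance_ge0.
case: ltP => // good1; case: ltP => // good2; exfalso.
move: bad; apply/negP; rewrite -leNgt.
rewrite -(ler_pM2r nR) dev; apply: le_trans good1 _.
set q := Num.sqrt var in good2 *; set d := Num.sqrt D.
have d2 : d ^+ 2 = D by rewrite sqr_sqrtr ?ltW.
have d0' : 0 <= d by exact: sqrtr_ge0.
pose w := Num.sqrt u; pose a := Num.sqrt (2 * l).
have a0 : 0 <= a by exact: sqrtr_ge0.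
have a2 : a ^+ 2 = 2 * l by rewrite sqr_sqrtr// mulr_ge0.
have -> : Num.sqrt (2 * u * l) = w * a.
  by rewrite -sqrtrM//; congr Num.sqrt; ring.
have -> : Num.sqrt (2 * (n%:R * var) * L) = q * a * n%:R.
  have -> : 2 * (n%:R * var) * L = var * (2 * l) * n%:R ^+ 2 by rewrite Ll; ring.
  by rewrite sqrtrM ?mulr_ge0// [X in X * _]sqrtrM// sqrtr_sqr ger0_norm ?ler0n.
set b := Num.sqrt (6 * D * L / n%:R) in good2.
have b0 : 0 <= b by exact: sqrtr_ge0.
have b2 : b ^+ 2 = 6 * D * l.
  rewrite sqr_sqrtr; first by rewrite -mulrA.
  by rewrite divr_ge0 ?ler0n// !mulr_ge0 ?(ltW D0).
have dl0 : 0 <= d * l by rewrite mulr_ge0.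
have ba : b * a <= 7 / 2 * (d * l).
  rewrite -ler_sqr ?nnegrE ?mulr_ge0//.
  have -> : (7 / 2 * (d * l)) ^+ 2 = 49 / 4 * (d ^+ 2 * l ^+ 2) by field.
  rewrite exprMn b2 a2 d2.
  have : 0 <= D * l ^+ 2 by rewrite mulr_ge0 ?sqr_ge0 ?ltW.
  by rewrite !expr2; lra.
have sD : Num.sqrt (2 * D) <= 10 / 7 * d.
  apply: sqrt_le_of_sqr; first by rewrite mulr_ge0.
  have -> : (10 / 7 * d) ^+ 2 = 100 / 49 * d ^+ 2 by field.
  by rewrite d2; lra.
have qa : q * a <= (w + b) * a by rewrite ler_wpM2r.
have sl : Num.sqrt (2 * D) * l <= 10 / 7 * d * l by rewrite ler_wpM2r.
rewrite Ll.
have -> : q * a * n%:R + 5 / 4 * (Num.sqrt (2 * D) * (n%:R * l)) =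
  (q * a + 5 / 4 * (Num.sqrt (2 * D) * l)) * n%:R by ring.
by rewrite ler_pM2r//; lra.
Qed.

End combination.

(** * Simple functions and their integrals *)

Section simple_functions.
Context {d : measure_display} {T : measurableType d} {R : realType}.
Context {V : normedModType R} (P : probability T R).
Implicit Types s : T -> V.

Lemma measurable_simple2 s s' (F : V -> V -> R) :
  simple_function s -> simple_function s' ->
  measurable_fun setT (fun x => F (s x) (s' x)).
Proof.
move=> [fs ms] [fs' ms'] _ B mB; rewrite setTI.
have -> : (fun x => F (s x) (s' x)) @^-1` B =
    \bigcup_(v in range s) \bigcup_(v' in range s')
      (s @^-1` [set v] `&` s' @^-1` [set v'] `&` [set _ | B (F v v')]).
  apply/seteqP; split=> x /=.
    move=> Bx; exists (s x); first by exists x.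
    by exists (s' x); first by exists x.
  by move=> [_ [y _ <-] [_ [y' _ <-] [[/= -> ->]]]].
apply: fin_bigcup_measurable => // v _.
apply: fin_bigcup_measurable => // v' _.
apply: measurableI; first exact: measurableI.
have [BF|BF] := pselect (B (F v v')).
  by rewrite (_ : [set _ | _] = setT)//; apply/seteqP; split.
by rewrite (_ : [set _ | _] = set0)//; apply/seteqP; split.
Qed.

Lemma measurable_simple s (F : V -> R) :
  simple_function s -> measurable_fun setT (F \o s).
Proof. by move=> ss; exact: (measurable_simple2 (fun v _ => F v) ss ss). Qed.

Lemma integrable_simple s (F : V -> R) :
  simple_function s -> P.-integrable setT (EFin \o (F \o s)).
Proof.
move=> ss; apply: measurable_bounded_integrable => //.
- by apply: (le_lt_trans (probability_le1 P _)); rewrite ?ltry.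
- exact: measurable_simple.
have [fs _] := ss.
pose M := \sum_(v <- fset_set (range s)) `|F v|.
exists M; split; first exact: num_real.
move=> y My x _ /=; apply: le_trans (ltW My).
have sx : s x \in fset_set (range s) by rewrite in_fset_set// inE; exists x.
by rewrite /M (big_fsetD1 (s x))//= lerDl; apply: sumr_ge0.
Qed.

Lemma sum_law_simple s : simple_function s ->
  \sum_(v <- fset_set (range s)) fine (P (s @^-1` [set v])) = 1.
Proof.
move=> [fs ms].
have : P (\bigcup_(v in range s) s @^-1` [set v]) = 1%E.
  rewrite (_ : \bigcup_(_ in _) _ = setT) ?probability_setT//.
  by apply/seteqP; split=> // x _; exists (s x) => //; exists x.
rewrite measure_fin_bigcup//; last exact: trivIset_preimage1.
rewrite fsbig_finite//= => /(congr1 fine) /= <-.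
by rewrite sum_fine// => v _; exact: fin_num_measure.
Qed.

Lemma simple_integralE s : simple_function s ->
  simple_integral P s =
  \sum_(v <- fset_set (range s)) fine (P (s @^-1` [set v])) *: v.
Proof. by move=> [fs _]; rewrite /simple_integral fsbig_finite. Qed.

Lemma integral_comp_simple s (F : V -> R) : simple_function s ->
  (\int[P]_x (F (s x))%:E)%E =
  (\sum_(v <- fset_set (range s)) fine (P (s @^-1` [set v])) * F v)%:E.
Proof.
move=> ss; have [fs ms] := ss.
have FE x : (F (s x))%:E =
    (\sum_(v <- fset_set (range s)) (F v)%:E * (\1_(s @^-1` [set v]) x)%:E)%E.
  have sx : s x \in fset_set (range s) by rewrite in_fset_set// inE; exists x.
  rewrite (big_fsetD1 (s x))//= indicE mem_set// mule1.
  rewrite big1_fset ?adde0// => v; rewrite !inE => /andP[vx _] _.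
  by rewrite indicE memNset ?mule0// => /= E; rewrite E eqxx in vx.
under eq_integral do rewrite FE.
rewrite integral_sum//; last first.
  by move=> v; apply: integrableZl => //; exact: integrable_indic.
rewrite -sumEFin; apply: eq_bigr => v _.
rewrite integralZl//; last exact: integrable_indic.
rewrite integral_indic// setIT EFinM fineK; last by apply: fin_num_measure; exact: ms.
by rewrite [RHS]muleC.
Qed.

Variable dot : {dot V for @idfun R}.
Hypothesis normE : forall f, `|f| ^+ 2 = dot f f.

Lemma dot_simple_integral s z : simple_function s ->
  (dot (simple_integral P s) z)%:E = (\int[P]_x (dot (s x) z)%:E)%E.
Proof.
move=> ss; rewrite simple_integralE// (integral_comp_simple (dot ^~ z))//.
rewrite !big_seq_fsetE /= (dot_suml dot).
by [].
Qed.

(** The two simple functions live on different partitions; pairing the difference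
    [z] of the integrals with itself avoids a common refinement, as
    [dot _ z] turns simple integrals into integrals of real functions. *)
Lemma simple_integral_dist (f : T -> V) s s' :
  simple_function s -> simple_function s' ->
  measurable_fun setT (fun x => `|f x - s x|) ->
  measurable_fun setT (fun x => `|f x - s' x|) ->
  (`|simple_integral P s - simple_integral P s'|%:E <=
   \int[P]_x (`|f x - s x|)%:E + \int[P]_x (`|f x - s' x|)%:E)%E.
Proof.
move=> ss ss' ms ms'; set z := _ - _.
have i0 g : (0 <= \int[P]_x (`|f x - g x|)%:E)%E.
  by apply: integral_ge0 => x _; rewrite lee_fin.
have [z0|zN0] := eqVneq `|z| 0; first by rewrite z0 adde_ge0.
have z0 : 0 < `|z| by rewrite lt_def zN0 normr_ge0.
rewrite -ge0_integralD//; try (by move=> x _; rewrite lee_fin);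
  try exact/measurable_EFinP.
rewrite -(@lee_pmul2l _ `|z|%:E)// -EFinM -expr2.
pose g x : \bar R := (`|f x - s x|%:E + `|f x - s' x|%:E)%E.
have mD : measurable_fun setT g.
  by apply: emeasurable_funD; exact/measurable_EFinP.
have D0 x : setT x -> (0 <= g x)%E.
  by move=> _; rewrite /g adde_ge0 ?lee_fin.
rewrite -(ge0_integralZl_EFin P measurableT D0 mD)//.
rewrite normE {1}/z linearBl /= EFinB !dot_simple_integral//.
rewrite -integralB_EFin//; try exact: (integrable_simple (dot ^~ z)).
apply: (@le_trans _ _ (\int[P]_x (`|dot (s x - s' x) z|)%:E)%E).
  apply: le_trans (lee_abs _) _.
  apply: le_trans (le_abse_integral _ _ _) _ => //.
    apply: emeasurable_funB; apply/measurable_EFinP;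
      exact: (measurable_simple (dot ^~ z)).
  rewrite le_eqVlt; apply/orP; left; apply/eqP; apply: eq_integral => x _.
  by rewrite -EFinB linearBl.
apply: ge0_le_integral => //.
- apply/measurable_EFinP.
  exact: (measurable_simple2 (fun u v => `|dot (u - v) z|)).
- apply/measurable_EFinP; apply: measurable_funM => //.
  exact: measurable_funD.
move=> x _; rewrite /g -EFinD -EFinM lee_fin.
apply: le_trans (cauchy_schwarz normE _ _) _.
rewrite mulrC ler_wpM2l//.
have -> : s x - s' x = (f x - s' x) - (f x - s x).
  by rewrite opprB [RHS]addrC addrA subrK.
by rewrite [leRHS]addrC; exact: ler_normB.
Qed.

End simple_functions.

(** * Existence and uniqueness of Bochner integrals *)

Section bochner_theory.
Context {d : measure_display} {T : measurableType d} {R : realType}.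
Context {V : completeNormedModType R} (P : probability T R).
Variable dot : {dot V for @idfun R}.
Hypothesis normE : forall f, `|f| ^+ 2 = dot f f.
Implicit Types (f s : T -> V).

Lemma measurable_dist_simple f s (s_ : nat -> T -> V) :
  (forall m, simple_function (s_ m)) -> (forall x, s_ m x @[m --> \oo] --> f x) ->
  simple_function s -> measurable_fun setT (fun x => `|f x - s x|).
Proof.
move=> ss_ cs ss.
apply: (measurable_fun_cvg (h := fun m x => `|s_ m x - s x|)).
  by move=> m; exact: (measurable_simple2 (fun u v => `|u - v|)).
by move=> x _; apply: cvg_norm; apply: cvgB => //; exact: cvg_cst.
Qed.

(** Two approximating sequences have the same limit of integrals, since both are
    close to [f] in mean. *)
Lemma bochner_integral_unique f I J :
  is_bochner_integral P f I -> is_bochner_integral P f J -> I = J.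
Proof.
move=> [s [ss cs is0 Is]] [s' [ss' cs' is0' Js]].
apply/eqP; rewrite -subr_eq0 -normr_le0 -lee_fin.
have c1 : (`|simple_integral P (s m) - simple_integral P (s' m)|%:E)
    @[m --> \oo] --> (`|I - J|)%:E.
  by apply: cvg_EFin; [exact: nearW|apply: cvg_norm; exact: cvgB].
have c2 : (\int[P]_x (`|f x - s m x|)%:E + \int[P]_x (`|f x - s' m x|)%:E)%E
    @[m --> \oo] --> (0 + 0)%E by exact: cvgeD.
rewrite adde0 in c2; apply: (lee_cvg_to c1 c2).
apply: nearW => m.
exact: (@simple_integral_dist _ _ _ _ P dot normE f _ _ (ss m) (ss' m)
  (measurable_dist_simple ss cs (ss m)) (measurable_dist_simple ss cs (ss' m))).
Qed.

(** Dominated convergence gives convergence in mean, which makes the sequence of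
    simple integrals a Cauchy sequence. *)
Lemma ex_bochner_integral f C (s : nat -> T -> V) :
  (forall m, simple_function (s m)) -> (forall x, s m x @[m --> \oo] --> f x) ->
  (forall m x, `|s m x| <= C) ->
  exists2 I, simple_integral P (s m) @[m --> \oo] --> I & is_bochner_integral P f I.
Proof.
move=> ss cs sC.
have fC x : `|f x| <= C.
  apply: (ler_cvg_to (cvg_norm (cs x)) (cvg_cst C)).
  by apply: nearW => m; exact: sC.
have md m := measurable_dist_simple ss cs (ss m).
have dom x : (`|f x - s m x|)%:E @[m --> \oo] --> 0%E.
  apply: cvg_EFin; first exact: nearW.
  have -> : 0 = `|f x - f x| :> R by rewrite subrr normr0.
  by apply: cvg_norm; apply: cvgB => //; exact: cvg_cst.
have d0 : (\int[P]_x (`|f x - s m x|)%:E)%E @[m --> \oo] --> 0%E.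
  have C0 : 0 <= C by apply: le_trans (fC point).
  rewrite -(integral0 P setT).
  have := @dominated_convergence _ T R P setT measurableT
    (fun m x => (`|f x - s m x|)%:E) (cst 0%E) (cst (C + C)%:E).
  case.
  - by move=> m; apply/measurable_EFinP; exact: md.
  - exact: measurable_cst.
  - by apply/nearW => x _; exact: dom.
  - exact: finite_measure_integrable_cst.
  - apply/nearW => x m _; rewrite /= normr_id lee_fin.
    by apply: le_trans (ler_normB _ _) _; rewrite lerD.
  - by [].
have cc : cvg (simple_integral P (s m) @[m --> \oo]).
  apply/cauchy_cvgP; apply: cauchy_exP => e e0.
  have e2 : 0 < e / 2 by rewrite divr_gt0.
  have [/= F1 F2] := (fine_cvgP _ _).1 d0.
  have F3 := cvgr_lt _ F2 _ e2.
  have : \forall m \near \oo, (\int[P]_x (`|f x - s m x|)%:E < (e / 2)%:E)%E.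
    by apply: filterS2 F1 (F3 _) => m f1 f3; rewrite -(fineK f1) lte_fin.
  move=> [N _ HN]; exists (simple_integral P (s N)), N => // m Nm.
  rewrite -ball_normE /= -lte_fin.
  apply: le_lt_trans (@simple_integral_dist _ _ _ _ P dot normE f _ _
    (ss N) (ss m) (md N) (md m)) _.
  by rewrite [e]splitr EFinD; apply: lteD; apply: HN => /=.
exists (lim (simple_integral P (s m) @[m --> \oo])) => //.
by exists s; split.
Qed.

End bochner_theory.

(** * Simple approximation of a continuous map on a separable space *)

Section simple_approximation.
Context {R : realType} {S : PreTopologicalZmodule.type} {V : normedModType R}.
Variable f : S -> V.
Hypothesis f_continuous : continuous f.

(** The value, among [f (g 0), ..., f (g m)], nearest to [f x]. Taking a nearest
    value, rather than a truncation, keeps the approximations in the range of [f],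
    hence within the same diameter. *)
Fixpoint nearest_value (g : nat -> S) (m : nat) (x : borel S) : V :=
  if m is m'.+1 then
    if `|f x - f (g m)| < `|f x - nearest_value g m' x| then f (g m)
    else nearest_value g m' x
  else f (g 0%N).

Lemma nearest_value_le g m j x : (j <= m)%N ->
  `|f x - nearest_value g m x| <= `|f x - f (g j)|.
Proof.
elim: m => [|m IH]; first by rewrite leqn0 => /eqP ->.
rewrite leq_eqVlt => /orP[/eqP ->|jm] /=; case: ltP => // h; last exact: IH.
by apply: le_trans (ltW h) _; exact: IH.
Qed.

Lemma nearest_value_range g m x : exists y, nearest_value g m x = f y.
Proof.
elim: m => [|m [y IH]] /=; first by exists (g 0%N).
by case: ifP => _; [exists (g m.+1)|exists y].
Qed.

Lemma measurable_nearer (a b : V) :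
  measurable ([set x | `|f x - a| < `|f x - b|] : set (borel S)).
Proof.
apply: sub_sigma_algebra.
pose h x : R := `|f x - a| - `|f x - b|.
have -> : [set x | `|f x - a| < `|f x - b|] = h @^-1` [set y | y < 0].
  by apply/seteqP; split => x /=; rewrite /h subr_lt0.
apply: open_comp; last exact: open_lt.
move=> x _; apply: cvgB; apply: cvg_norm; apply: cvgB;
  by [exact: f_continuous|exact: cvg_cst].
Qed.

Lemma simple_nearest_value g m : simple_function (nearest_value g m).
Proof.
elim: m => [|m [fin IH]].
  split.
    apply: (sub_finite_set (B := [set f (g 0%N)])) => //.
    by move=> _ [x _ <-].
  move=> v; have [<-|vN] := eqVneq (f (g 0%N)) v.
    by rewrite (_ : _ @^-1` _ = setT)//; apply/seteqP; split.
  rewrite (_ : _ @^-1` _ = set0)//; apply/seteqP; split => // x /= /eqP.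
  by rewrite (negbTE vN).
split.
  apply: (sub_finite_set (B := [set f (g m.+1)] `|` range (nearest_value g m))).
    by move=> _ [x _ <-] /=; case: ifP => _; [left|right; exists x].
  by rewrite finite_setU; split.
pose A := [set x | `|f x - f (g m.+1)| < `|f x - nearest_value g m x|].
have mA : measurable (A : set (borel S)).
  have -> : A = \bigcup_(v in range (nearest_value g m))
     (nearest_value g m @^-1` [set v] `&` [set x | `|f x - f (g m.+1)| < `|f x - v|]).
    apply/seteqP; split => x /=.
      by move=> Ax; exists (nearest_value g m x) => //; exists x.
    by move=> [v _ [/= <-]].
  apply: fin_bigcup_measurable => // v _.
  by apply: measurableI => //; exact: measurable_nearer.
move=> v.
have -> : nearest_value g m.+1 @^-1` [set v] =
    (A `&` [set _ | f (g m.+1) = v]) `|` (~` A `&` nearest_value g m @^-1` [set v]).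
  apply/seteqP; split => x /=; rewrite /A /=; case: ifP => h.
  - by move=> ->; left.
  - by move=> ->; right; split.
  - by move=> [[_ ->]//|[]].
  - by move=> [[]|[]].
apply: measurableU; apply: measurableI => //; last exact: measurableC.
have [gv|gv] := pselect (f (g m.+1) = v).
  by rewrite (_ : [set _ | _] = setT)//; apply/seteqP; split.
by rewrite (_ : [set _ | _] = set0)//; apply/seteqP; split.
Qed.

Lemma ex_simple_approximation : separable S ->
  exists s : nat -> borel S -> V,
    [/\ forall m, simple_function (s m),
        forall x, s m x @[m --> \oo] --> f x
      & forall m x, exists y, s m x = f y].
Proof.
move=> [D [cD dD]].
have [g gD] : exists g : nat -> borel S, set_surj [set: nat] (D : set (borel S)) g.
  exact/pcard_surjP.
exists (nearest_value g); split; first exact: simple_nearest_value.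
  move=> x; apply/cvgrPdist_lt => e e0.
  pose O := [set y | `|f x - f y| < e].
  have Oo : open O.
    pose h y : R := `|f x - f y|.
    apply: (@open_comp _ _ h [set r | r < e]); last exact: open_lt.
    move=> y _; apply: cvg_norm; apply: cvgB; by [exact: f_continuous|exact: cvg_cst].
  have [y [Oy Dy]] : O `&` D !=set0.
    by apply: dD => //; exists x; rewrite /O /= subrr normr0.
  have [j _ gj] := gD _ Dy.
  exists j => // m /= jm.
  by apply: le_lt_trans (nearest_value_le _ _ jm) _; rewrite gj.
by move=> m x; exact: nearest_value_range.
Qed.

End simple_approximation.

(** * Samples of a simple function *)

(** The event of the theorem is that this quantity is nonpositive: in this form
    it is a continuous function of the sample, which goes to the limit. *)
Definition bernstein_excess (R : realType) (V : normedModType R) n (delta D : R) (m : V)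
    (x : 'I_n -> V) : R :=
  `|n%:R^-1 *: \sum_t x t - m| -
  (Num.sqrt (2 * empirical_variance x * (ln (4 / delta) / n%:R))
   + 16 / 3 * Num.sqrt D * (ln (4 / delta) / n%:R)).

Section simple_sample.
Context {d d' : measure_display} {Omega : measurableType d} {T : measurableType d'}.
Context {R : realType} (Pr : probability Omega R) (P : probability T R).
Context (n : nat) (X : 'I_n -> {RV Pr >-> T}).
Hypothesis X_iid : iid P X.
Context {V : normedModType R} (s : T -> V).
Hypothesis s_simple : simple_function s.

(* A simple function of the sample is a function of the [I]-valued sample [Y],
   whose law is the product of the weights [p]: this reduces probabilities to
   the finite expectations above. *)
Let I : finType := fset_set (range s).

Lemma in_values x : s x \in fset_set (range s).
Proof. by have [fs _] := s_simple; rewrite in_fset_set// inE; exists x. Qed.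

Let Y (w : Omega) : {ffun 'I_n -> I} := [ffun t => [` in_values (X t w)]%fset].

Let p (i : I) : R := fine (P (s @^-1` [set val i])).

Lemma sampleE w : (fun t => val (Y w t)) = (fun t => s (X t w)).
Proof. by apply/funext => t; rewrite ffunE. Qed.

Lemma measurable_value t (i : I) : measurable (X t @^-1` (s @^-1` [set val i])).
Proof.
have [_ ms] := s_simple.
by rewrite -[X in measurable X]setTI; exact: measurable_funP.
Qed.

Lemma sample_fiberE (f : {ffun 'I_n -> I}) : Y @^-1` [set f] =
  \bigcap_(t in [set` [set: 'I_n]%SET]) (X t @^-1` (s @^-1` [set val (f t)])).
Proof.
apply/seteqP; split => w /=.
  by move=> <- t _ /=; rewrite ffunE.
move=> h; apply/ffunP => t; apply: val_inj; rewrite ffunE /=.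
by apply: (h t); rewrite /= inE.
Qed.

Lemma measurable_sample_fiber f : measurable (Y @^-1` [set f]).
Proof.
rewrite sample_fiberE; apply: fin_bigcap_measurable => //.
by move=> t _; exact: measurable_value.
Qed.

Lemma sample_law f : Pr (Y @^-1` [set f]) = (\prod_t p (f t))%:E.
Proof.
have [_ ms] := s_simple; have [mi ed] := X_iid.
rewrite sample_fiberE (mi _ (fun t => s @^-1` [set val (f t)])) => [|t]; last exact: ms.
rewrite -prodEFin; apply: eq_big => [t|t _]; first by rewrite inE.
rewrite /p fineK; last by apply: fin_num_measure; exact: ms.
by rewrite -(ed t) //; exact: ms.
Qed.

Lemma measurable_sample_set (A : pred {ffun 'I_n -> I}) :
  measurable [set w | A (Y w)].
Proof.
rewrite (_ : [set w | A (Y w)] = \bigcup_(f in [set` A]) Y @^-1` [set f]).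
  by apply: fin_bigcup_measurable => // f _; exact: measurable_sample_fiber.
by apply/seteqP; split=> [w Aw|w [f Af /= ->]]//; exists (Y w).
Qed.

Lemma measurable_sample_fun (F : ('I_n -> V) -> R) :
  measurable_fun setT (fun w => F (fun t => s (X t w))).
Proof.
move=> _ B _; rewrite setTI.
rewrite (_ : _ @^-1` B = [set w | `[< B (F (fun t => val (Y w t))) >]]).
  exact: (measurable_sample_set (fun f => `[< B (F (fun t => val (f t))) >])).
by apply/seteqP; split => w /=; rewrite sampleE => /asboolP.
Qed.

Lemma sample_prob (A : pred {ffun 'I_n -> I}) :
  Pr [set w | A (Y w)] = (expect p (fun f => (A f)%:R))%:E.
Proof.
rewrite (_ : [set w | A (Y w)] = \bigcup_(f in [set` A]) Y @^-1` [set f]); last first.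
  by apply/seteqP; split=> [w Aw|w [f Af /= ->]]//; exists (Y w).
rewrite measure_fin_bigcup//; last 2 first.
- exact: trivIset_preimage1.
- by move=> f _; exact: measurable_sample_fiber.
rewrite /expect -sumEFin -(bigfs _ (index_enum_uniq _)); last first.
  by move=> f _; rewrite mem_index_enum.
rewrite big_mkcond; apply: eq_bigr => f _.
by case: (A f); rewrite ?mulr1 ?mulr0//; exact: sample_law.
Qed.

Variable dot : {dot V for @idfun R}.
Hypothesis normE : forall f, `|f| ^+ 2 = dot f f.

(** The finite inequality, read on the finitely many values of [s]. *)
Lemma simple_empirical_bernstein D delta :
  (forall x y, `|s x - s y| ^+ 2 / 2 <= D) ->
  (2 <= n)%N -> 0 < delta -> delta < 1 -> 0 <= D ->
  ((1 - delta)%:E <=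
   Pr [set w | (bernstein_excess delta D (simple_integral P s)
     (fun t => s (X t w)) <= 0)%R])%E.
Proof.
move=> sD n2 d0 d1 D0.
have p0 i : 0 <= p i by exact: fine_ge0.
have p1 : \sum_i p i = 1 by rewrite -(sum_law_simple P s_simple) big_seq_fsetE.
have mE : simple_integral P s = \sum_i p i *: val i.
  by rewrite simple_integralE// big_seq_fsetE.
have hD (i j : I) : `|val i - val j| ^+ 2 / 2 <= D.
  have [fs _] := s_simple.
  have vI (k : I) : exists x, s x = val k.
    by have := valP k; rewrite in_fset_set// inE => -[x _ <-]; exists x.
  by have [x <-] := vI i; have [y <-] := vI j.
have B := finite_empirical_bernstein normE p0 p1 hD n2 d0 d1 D0.
pose A (f : {ffun 'I_n -> I}) :=
  0 < bernstein_excess delta D (simple_integral P s) (fun t => val (f t)).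
have -> : [set w | bernstein_excess delta D (simple_integral P s)
    (fun t => s (X t w)) <= 0] = ~` [set w | A (Y w)].
  apply/seteqP; split => w /=; rewrite /A sampleE ltNge.
    by move=> ->.
  by move/negP; rewrite negbK.
rewrite probability_setC; last exact: measurable_sample_set.
rewrite sample_prob -EFinB lee_fin lerB//.
apply: le_trans B; rewrite le_eqVlt; apply/orP; left; apply/eqP.
by apply: eq_expect => f; rewrite /A /bernstein_excess subr_gt0 mE.
Qed.

End simple_sample.

(** * Passage to the limit *)

(** Reverse Fatou: a point that satisfies [Z_ m w <= 0] for infinitely many [m]
    satisfies [Z w <= 0], and the probability of the limit superior of events is
    at least any common lower bound of their probabilities. *)
Lemma probability_le0_limit d (T : measurableType d) (R : realType)
    (Pr : probability T R) (Z_ : nat -> T -> R) (Z : T -> R) (a : \bar R) :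
  (forall m, measurable_fun setT (Z_ m)) ->
  (forall w, Z_ m w @[m --> \oo] --> Z w) ->
  (forall m, (a <= Pr [set w | (Z_ m w <= 0)%R])%E) ->
  (a <= Pr [set w | (Z w <= 0)%R])%E.
Proof.
move=> mZ_ cZ aZ.
have mle (f : T -> R) : measurable_fun setT f -> measurable [set w | f w <= 0].
  move=> mf; have := mf measurableT _ (measurable_itv `]-oo, 0]).
  by rewrite setTI; congr measurable; apply/seteqP; split => w /=; rewrite in_itv.
have mZ : measurable_fun setT Z by apply: measurable_fun_cvg mZ_ _ => w _.
pose F m := [set w | Z_ m w <= 0].
have mF m : measurable (F m) by exact: mle.
apply: (@le_trans _ _ (Pr (lim_sup_set F))); last first.
  apply: le_measure; rewrite ?inE; [|exact: mle|].
    by apply: bigcap_measurable => // k _; exact: bigcup_measurable.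
  move=> w Fw /=; rewrite leNgt; apply/negP => Z0.
  have [N _ HN] := cvgr_gt _ (cZ w) _ Z0.
  have [m Nm] := Fw N Logic.I; rewrite /F /= leNgt => /negP; apply.
  exact: HN.
have mU m : measurable (\bigcup_(j >= m) F j) by exact: bigcup_measurable.
have C : Pr (\bigcup_(j >= m) F j) @[m --> \oo] --> Pr (lim_sup_set F).
  apply: lim_sup_set_cvg => //.
  by apply: le_lt_trans (probability_le1 Pr (mU 0)) _; rewrite ltry.
apply: (cvge_to_ge C).
apply: nearW => m; apply: le_trans (aZ m) _.
apply: le_measure; rewrite ?inE; [exact: mF|exact: bigcup_measurable|].
by move=> w Zw; exists m => /=.
Qed.

Lemma cvg_bernstein_excess (R : realType) (V : normedModType R) n (delta D : R)
    (m_ : nat -> V) (m : V) (x_ : nat -> 'I_n -> V) (x : 'I_n -> V) :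
  m_ j @[j --> \oo] --> m -> (forall t, x_ j t @[j --> \oo] --> x t) ->
  bernstein_excess delta D (m_ j) (x_ j) @[j --> \oo] --> bernstein_excess delta D m x.
Proof.
move=> cm cx; apply: cvgB.
  apply: cvg_norm; apply: cvgB => //; apply: cvgZl_tmp.
  by apply: cvg_big => //; exact: add_continuous.
apply: cvgD; last exact: cvg_cst.
apply: continuous_cvg; first exact: sqrt_continuous.
apply: cvgMr_tmp; apply: cvgMl_tmp; apply: cvgMl_tmp.
apply: cvg_big => [|t _]; first exact: add_continuous.
apply: cvg_big => [|u _]; first exact: add_continuous.
apply: cvgMr_tmp; rewrite /GRing.exp /=.
by apply: cvgM; apply: cvg_norm; apply: cvgB.
Qed.

(** * Kernel sections of a translation invariant kernel *)

Section translation_invariant_rkhs.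
Context {R : realType} {S : PreTopologicalZmodule.type} {k : S -> S -> R}.
Context {psi : S -> R} (H : rkhs k).
Hypothesis k_psi : forall x x', k x x' = psi (x' - x).
Local Notation phi := (rkhs_section H).
Local Notation dot := (rkhs_dot H).

Lemma dot_section x y : dot (phi x) (phi y) = psi (y - x).
Proof. by rewrite -rkhs_reproducing rkhs_sectionE k_psi. Qed.

Lemma sqr_norm_section x : `|phi x| ^+ 2 = psi 0.
Proof. by rewrite rkhs_normE dot_section subrr. Qed.

Lemma psi_sym x y : psi (x - y) = psi (y - x).
Proof. by rewrite -!dot_section (dotC dot). Qed.

(** Distances between sections are controlled by [psi] alone: this identity
    turns [vhat] into a sample variance and bounds the diameter of the sections
    by [psi_range]. *)
Lemma section_dist x y : `|phi x - phi y| ^+ 2 / 2 = psi 0 - psi (x - y).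
Proof.
rewrite (sqr_normB (rkhs_normE (r := H))) !sqr_norm_section dot_section psi_sym.
by field.
Qed.

(** Cauchy-Schwarz for two sections, which have the same norm. *)
Lemma psi_le z : `|psi z| <= psi 0.
Proof.
have := cauchy_schwarz (rkhs_normE (r := H)) (phi 0) (phi z).
rewrite dot_section subr0 => /le_trans; apply.
suff -> : `|phi 0| = `|phi z| by rewrite -expr2 sqr_norm_section.
apply/eqP; rewrite -(@eqrXn2 _ 2) ?normr_ge0//.
by rewrite !sqr_norm_section.
Qed.

Lemma sup_psi : sup (range psi) = psi 0.
Proof.
apply/eqP; rewrite eq_le; apply/andP; split.
  apply: ge_sup; first by exists (psi 0); exists 0.
  by move=> _ [z _ <-]; apply: le_trans (ler_norm _) (psi_le z).
apply: ub_le_sup; last by exists 0.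
by exists (psi 0) => _ [z _ <-]; apply: le_trans (ler_norm _) (psi_le z).
Qed.

Lemma section_dist_le_range x y : `|phi x - phi y| ^+ 2 / 2 <= psi_range psi.
Proof.
rewrite section_dist /psi_range sup_psi lerD2l lerN2.
apply: ge_inf; last by exists (x - y).
by exists (- psi 0) => _ [z _ <-]; have := psi_le z; rewrite ler_norml => /andP[].
Qed.

Lemma vhatE n (x : 'I_n -> S) : (2 <= n)%N ->
  vhat psi x = empirical_variance (fun t => phi (x t)).
Proof.
move=> n2; rewrite /vhat sup_psi /empirical_variance.
under [in RHS]eq_bigr do under eq_bigr do rewrite section_dist.
under [in RHS]eq_bigr do rewrite sumrB.
rewrite sumrB mulrBr; congr (_ - _).
have tE (t : 'I_n) : \sum_(s | t != s) psi 0 = (n%:R - 1) * psi 0.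
  by rewrite sumr_const card_neq -[LHS]mulr_natl -subn1 natrB//; lia.
under eq_bigr do rewrite tE.
rewrite sumr_const card_ord -(mulr_natl ((n%:R - 1) * psi 0) n).
have nR : n%:R != 0 :> R by rewrite pnatr_eq0; lia.
have n1R : n%:R - 1 != 0 :> R by rewrite subr_eq0 (eqr_nat _ _ 1); lia.
by field; rewrite nR n1R.
Qed.

(** Continuity of the kernel at [(x, x)] makes
    [|phi x - phi y|^2 = 2 (k x x - k x y)] tend to 0 as [y] tends to [x]. *)
Lemma section_continuous : continuous (fun z : S * S => k z.1 z.2) -> continuous phi.
Proof.
move=> kc x; apply/cvgrPdist_lt => e e0.
have ck : k x y @[y --> x] --> k x x.
  have cp : (x, y) @[y --> x] --> (x, x) by apply: cvg_pair; [exact: cvg_cst|exact: cvg_id].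
  exact: cvg_comp cp (kc (x, x)).
have ke : k x x - e ^+ 2 / 2 < k x x by rewrite ltrBlDr ltrDl divr_gt0// exprn_gt0.
have : \forall y \near x, k x x - e ^+ 2 / 2 < k x y by exact: (cvgr_gt _ ck _ ke).
apply: filterS => y.
rewrite !k_psi subrr => h.
rewrite -ltr_sqr ?nnegrE ?(ltW e0)//.
by have := section_dist x y; rewrite psi_sym; lra.
Qed.

End translation_invariant_rkhs.

Theorem theorem3p1 (R : realType) (S : PreTopologicalZmodule.type)
    (k : S -> S -> R) (psi : S -> R) (H : rkhs k)
    (d : measure_display) (Omega : measurableType d)
    (Pr : probability Omega R) (P : probability (borel S) R)
    (n : nat) (X : 'I_n -> {RV Pr >-> borel S}) (delta : R)
    (S_separable : separable S)
    (k_continuous : continuous (fun z : S * S => k z.1 z.2))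
    (k_bounded : has_ubound (range (fun x => k x x)))
    (k_pd : positive_definite_kernel k)
    (psi_pd : positive_definite_function psi)
    (k_translation_invariant : forall x x', k x x' = psi (x' - x))
    (k_characteristic : characteristic H)
    (n_ge2 : (2 <= n)%N)
    (X_iid : iid P X)
    (delta_gt0 : 0 < delta) (delta_lt1 : delta < 1) :
  ((1 - delta)%:E <=
   Pr [set w |
     (`|empirical_embedding H (fun t => X t w) - mean_embedding H P|
      <= Num.sqrt (2 * vhat psi (fun t => X t w) * (ln (4 / delta) / n%:R))
         + 16 / 3 * Num.sqrt (psi_range psi) * (ln (4 / delta) / n%:R))%R])%E.
Proof.
have normE := rkhs_normE (r := H).
have kpsi := k_translation_invariant.
have phic := section_continuous (H := H) kpsi k_continuous.
have [s [ss cs rs]] := ex_simple_approximation phic S_separable.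
have sC m x : `|s m x| <= Num.sqrt (psi 0).
  have [y ->] := rs m x.
  by rewrite -[leLHS]ger0_norm// -sqrtr_sqr (sqr_norm_section H kpsi).
have [I sI bI] := ex_bochner_integral P normE ss cs sC.
have mE : mean_embedding H P = I.
  rewrite /mean_embedding /bochner_integral; apply: xget_unique => //= J bJ.
  exact: (bochner_integral_unique normE bJ bI).
have D0 : 0 <= psi_range psi.
  by apply: le_trans (section_dist_le_range H kpsi 0 0); rewrite divr_ge0 ?sqr_ge0.
have sD m x y : `|s m x - s m y| ^+ 2 / 2 <= psi_range psi.
  have [x' ->] := rs m x; have [y' ->] := rs m y.
  exact: section_dist_le_range.
rewrite (_ : [set w | _] = [set w | bernstein_excess delta (psi_range psi) I
    (fun t => rkhs_section H (X t w)) <= 0]); last first.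
  apply/seteqP; split => w /=;
  by rewrite /bernstein_excess subr_le0 mE (vhatE H kpsi _ n_ge2).
apply: (probability_le0_limit (Z_ := fun m w => bernstein_excess delta (psi_range psi)
   (simple_integral P (s m)) (fun t => s m (X t w)))).
- move=> m.
  exact: (measurable_sample_fun X (ss m)
    (bernstein_excess delta (psi_range psi) (simple_integral P (s m)))).
- by move=> w; apply: cvg_bernstein_excess => // t; exact: cs.
- move=> m.
  exact: (simple_empirical_bernstein X_iid (ss m) normE (sD m)).
Qed.
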